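(* Let $c>0$ be the absolute constant from the Quantitative Helly Theorem recalled in the context. For every dimension $d\geq 1$ and every positive integer $p\geq 3d+1$, there is an integer $H=H(p,d)$ such that the following holds. Let $\mathcal{C}$ be a finite family of convex sets in $\mathbb{R}^d$, each containing an ellipsoid of volume one, and assume that among any $p$ members of $\mathcal{C}$ there exist $3d+1$ whose intersection contains an ellipsoid of volume one. Then $\mathcal{C}$ has quantitative $v$-transversal number at most $H(p,d)$ with $v=c^{d^2}d^{-5d^2/2+d}$.
   Context: An ellipsoid in $\mathbb{R}^d$ is the image of the closed Euclidean unit ball under an invertible affine map; volume is $d$-dimensional Lebesgue measure. For $v>0$, a family $T$ of ellipsoids of volume $v$ is a quantitative $v$-transversal of a family $\mathcal{C}$ of convex sets in $\mathbb{R}^d$ if every $C\in\mathcal{C}$ contains (as a subset) at least one ellipsoid from $T$. The quantitative $v$-transversal number $\tau(\mathcal{C},v)$ is the smallest cardinality of a quantitative $v$-transversal of $\mathcal{C}$; if some $C\in\mathcal{C}$ contains no ellipsoid of volume $v$, then $\tau(\mathcal{C},v)=\infty$. The constant $c>0$ is a fixed absolute constant (independent of $d$) for which the following known theorem holds for every $d\geq 1$ (Quantitative Helly Theorem): if $C_1,\ldots,C_n$ ($n\geq 2d$) are convex sets in $\mathbb{R}^d$ such that the intersection of any $2d$ of them contains an ellipsoid of volume at least one, then $\bigcap_{i=1}^n C_i$ contains an ellipsoid of volume at least $c^d d^{-3d/2}$. *)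

(* Defs.v *)
From HB Require Import structures.
From mathcomp Require Import all_boot all_order all_algebra.
From mathcomp Require Import all_classical all_reals all_analysis.

Set Implicit Arguments.
Unset Strict Implicit.
Unset Printing Implicit Defensive.

Import Order.TTheory GRing.Theory Num.Theory.
Import numFieldNormedType.Exports.

Local Open Scope classical_set_scope.
Local Open Scope ring_scope.

Section product_lebesgue_measure.
Local Open Scope ereal_scope.
Variable R : realType.
Notation RR := (measurableTypeR R).

Definition cons_pair n (xt : RR * n.-tuple RR) : n.+1.-tuple RR :=
  [the n.+1.-tuple RR of xt.1 :: xt.2].

Definition uncons_pair n (t : n.+1.-tuple RR) : RR * n.-tuple RR :=
  (tnth t ord0, [tuple of behead t]).

Lemma measurable_cons_pair n : measurable_fun [set: _] (@cons_pair n).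
Proof. exact: measurable_cons. Qed.

HB.instance Definition _ n := isMeasurableFun.Build _ _ _ _ (@cons_pair n)
  (@measurable_cons_pair n).

Lemma measurable_uncons_pair n : measurable_fun [set: _] (@uncons_pair n).
Proof.
apply/measurable_fun_pairP; split.
  exact: (@measurable_tnth _ RR n.+1 ord0).
exact: (@measurable_behead _ RR n).
Qed.

Lemma cons_pairK n : cancel (@cons_pair n) (@uncons_pair n).
Proof.
by move=> [x t]; rewrite /uncons_pair /cons_pair /=; congr pair; exact/val_inj.
Qed.

Section cons_measure.
Variables (n : nat) (mu : {sigma_finite_measure set (n.-tuple RR) -> \bar R}).

Definition cons_measure : set (n.+1.-tuple RR) -> \bar R :=
  pushforward (lebesgue_measure \x mu) (@cons_pair n).

Let cons_measure0 : cons_measure set0 = 0.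
Proof. exact: measure0. Qed.

Let cons_measure_ge0 A : 0 <= cons_measure A.
Proof. exact: measure_ge0. Qed.

Let cons_measure_sigma_additive : semi_sigma_additive cons_measure.
Proof. exact: measure_semi_sigma_additive. Qed.

HB.instance Definition _ := isMeasure.Build _ _ _ cons_measure
  cons_measure0 cons_measure_ge0 cons_measure_sigma_additive.

Let cons_measure_sigma_finite : sigma_finite [set: _] cons_measure.
Proof.
have /sigma_finiteP[F [FT ndF Foo]] :=
  sigma_finiteT (@lebesgue_measure R : {sigma_finite_measure set RR -> \bar R}).
have /sigma_finiteP[G [GT ndG Goo]] := sigma_finiteT mu.
exists (fun k => @uncons_pair n @^-1` (F k `*` G k)).
  rewrite -preimage_bigcup; apply/esym/seteqP; split=> // t _.
  have [i _ Fi] : (\bigcup_i F i) (uncons_pair t).1 by rewrite -FT.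
  have [j _ Gj] : (\bigcup_j G j) (uncons_pair t).2 by rewrite -GT.
  exists (maxn i j) => //; split.
    by move: Fi; exact/subsetPset/ndF/leq_maxl.
  by move: Gj; exact/subsetPset/ndG/leq_maxr.
move=> k; have [mF Fk] := Foo k; have [mG Gk] := Goo k; split.
  rewrite -[X in measurable X]setTI.
  by apply: measurable_uncons_pair => //; exact: measurableX.
rewrite /cons_measure /pushforward -comp_preimage.
rewrite (_ : _ \o _ = id) ?preimage_id; last exact/funext/cons_pairK.
by rewrite product_measure1E// lte_mul_pinfty// ge0_fin_numE.
Qed.

HB.instance Definition _ := Measure_isSigmaFinite.Build _ _ _ cons_measure
  cons_measure_sigma_finite.

End cons_measure.

(* the n-fold product of the Lebesgue measure on the line *)
Fixpoint lebesgue_tuple n : {sigma_finite_measure set (n.-tuple RR) -> \bar R} :=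
  if n is n'.+1 then cons_measure (lebesgue_tuple n') else \d_[tuple].

Lemma lebesgue_tuple_box n (a b : 'I_n -> R) : (forall i, (a i <= b i)%R) ->
  lebesgue_tuple n [set t | forall i, tnth t i \in `[a i, b i]] =
  (\prod_(i < n) (b i - a i))%:E.
Proof.
elim: n a b => [|n IH] a b ab.
  rewrite big_ord0 /= diracE mem_set// => i; by case: i.
rewrite big_ord_recl EFinM /=  /cons_measure /pushforward.
rewrite [X in product_measure1 _ _ X](_ : _ = `[a ord0, b ord0]%classic `*`
    [set t : n.-tuple RR | forall i, tnth t i \in
       `[a (lift ord0 i), b (lift ord0 i)]]); last first.
  apply/seteqP; split => -[x t] /=.
    move=> H; split; first by have := H ord0; rewrite tnth0.
    by move=> i; have := H (lift ord0 i); rewrite tnthS.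
  move=> [xa tH] i; case: (unliftP ord0 i) => [j|] ->.
    by rewrite tnthS; exact: tH.
  by rewrite tnth0.
rewrite product_measure1E//=; last first.
  rewrite [X in measurable X](_ : _ = \bigcap_(i in [set: 'I_n])
     ((fun t : n.-tuple RR => tnth t i) @^-1`
       `[a (lift ord0 i), b (lift ord0 i)]%classic)); last first.
    by apply/seteqP; split => t /= tH i; [move=> _|]; exact: tH.
  apply: fin_bigcap_measurable => // i _; rewrite -[X in measurable X]setTI.
  by apply: (@measurable_tnth _ RR n i) => //; exact: measurable_itv.
rewrite [X in (X * _)%E](_ : _ = (b ord0 - a ord0)%:E); last first.
  rewrite lebesgue_measure_itv/= lte_fin -EFinB.
  by case: ltgtP (ab ord0) => // -> _; rewrite subrr.
by rewrite (IH (fun i => a (lift ord0 i)) (fun i => b (lift ord0 i))).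
Qed.

End product_lebesgue_measure.

Section ellipsoids.
Variables (R : realType) (d : nat).
Implicit Types (E K : set 'rV[R]_d) (C T : set (set 'rV[R]_d)) (v : R).

Definition volume E : \bar R :=
  lebesgue_tuple R d [set t | E (\row_i tnth t i)].

(* The library's norm on row vectors is the sup norm, hence the explicit
   Euclidean norm here. *)
Definition euclidean_unit_ball : set 'rV[R]_d :=
  [set x | Num.sqrt (\sum_i x ord0 i ^+ 2) <= 1].

Definition is_ellipsoid E := exists (A : 'M[R]_d) (b : 'rV[R]_d),
  A \in unitmx /\ E = [set x *m A + b | x in euclidean_unit_ball].

Definition contains_ellipsoid K v :=
  exists E, [/\ is_ellipsoid E, volume E = v%:E & E `<=` K].

Definition contains_ellipsoid_ge K v :=
  exists E, [/\ is_ellipsoid E, (v%:E <= volume E)%E & E `<=` K].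

Definition is_transversal T C v :=
  (forall E, T E -> is_ellipsoid E /\ volume E = v%:E) /\
  (forall K, C K -> exists2 E, T E & E `<=` K).

(* The infimum is that of a set of natural numbers, so it is attained as soon
   as a finite transversal exists; otherwise it is +oo. *)
Definition transversal_number C v : \bar R :=
  ereal_inf [set n%:R%:E | n in
    [set n : nat | exists2 T, is_transversal T C v & (T #= `I_n)%card]].

End ellipsoids.

Definition quantitative_Helly (R : realType) (c : R) :=
  forall d n : nat, (1 <= d)%N -> (2 * d <= n)%N ->
  forall C : 'I_n -> set 'rV[R]_d,
    (forall i, convex_set (C i)) ->
    (forall I : {set 'I_n}, #|I| = (2 * d)%N ->
      contains_ellipsoid_ge (\bigcap_(i in [set` I]) C i) 1) ->
    contains_ellipsoid_ge (\bigcap_i C i)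
      (c ^+ d * d%:R `^ (- (3 * d%:R / 2))).

(* Main.v *)
Require Import Defs.
From mathcomp Require Import all_boot all_order all_algebra perm.
From mathcomp Require Import all_classical all_reals all_analysis measurable_realfun.
From mathcomp Require Import ring lra zify.

Set Implicit Arguments.
Unset Strict Implicit.
Unset Printing Implicit Defensive.

Import Order.TTheory GRing.Theory Num.Theory.
Import numFieldNormedType.Exports.

Local Open Scope classical_set_scope.
Local Open Scope ring_scope.

(** Why the theorem holds.  An ellipsoid is the image [ellipsoid A b] of the unit
ball [B] under [x |-> x A + b], so ellipsoids are points [(A, b)] of a vector
space of matrices and vectors, and [x A + b] is linear in [(A, b)]: for a convex
body [K], the parameters of the ellipsoids inside [K] form a convex set.  The
proof follows the scheme of Alon and Kleitman for the classical (p, q) theorem.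
Write [v0] for the volume [c^d d^(-3d/2)] granted by the quantitative Helly
property and [r = v0 / d^(d-1)], so that the volume in the statement is [r^d].

Determination.  Among any 3d + 1 compact convex bodies whose intersection
contains an ellipsoid of volume one, some ellipsoid of volume [r^d], computed
from 3d of the bodies only, is contained in the remaining one
([exists_redundant_body]).  For 2d of the bodies, consider an ellipsoid [E] of
volume one in their intersection contained in a ball around the origin of
minimal radius, and choose the 2d bodies for which this radius is largest.  Let
[H] be that ball.  Any 2d sets among [H] and all the bodies contain an ellipsoid
of volume one, so by the quantitative Helly property [H] and all the bodies
share an ellipsoid [F] of volume at least [v0].  On the other hand [E] has
maximal volume among the ellipsoids inside [H] and the 2d chosen bodies, since
a larger one could be shrunk away from the boundary of [H].  Comparing [E] with
convex combinations of [E] and rotated copies of [F] shows that, relative to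
[E], the triangular factors of [F] have diagonal entries at most [d]; as their
product is at least [v0], no entry is below [r], and [F] contains a translate of
[r E] ([stretch_lower_bound], [contains_scaled_translate]).  Now only the centre
of the translate is in question: the admissible centres form convex sets in
dimension [d], one for each of the d + 1 other bodies, and Helly's theorem shows
that the point nearest to the origin of the intersection of all but a suitable
one of them already belongs to that one ([one_set_redundant]).

From determination to popularity.  Call 3d + 1 bodies in good position if
their intersection contains an ellipsoid of volume one.  By hypothesis every
tuple of p (3d + 1) bodies, repetitions allowed, contains 3d + 1 such bodies.
Counting tuples turns this into an ellipsoid contained in a constant proportion
of the bodies, whatever multiplicities the bodies carry
([sampling_popular_tuple], [popular_weighted]).  Repeatedly picking a popular
ellipsoid and doubling the multiplicities of the bodies it misses, which plays
the part of linear programming duality, gives a finite sequence of ellipsoids of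
volume [r^d] of which every body contains a constant proportion
([fractional_cover_of_popular]).

From a sequence to boundedly many.  The parameters of these ellipsoids are
points of a space of dimension d^2 + d, where finite sequences of points have weak
epsilon-nets of bounded size ([weak_eps_net]).  Choosing triangular matrices with
positive diagonal as parameters, the points of the net still have determinant at
least as large, because such matrices with determinant at least [m] form a
convex set ([convex_upper_pos]); shrinking them gives volume exactly [r^d].

Compactness is needed for the extremal ellipsoids but the bodies need not be
closed: each body is replaced by the convex hull of finitely many ellipsoids
inside it, one for each tuple in good position that contains the body. *)

(** * Sampling and reweighting *)

(** Double counting: each of the [#|I| ^ #|P|] maps [f] yields, through one of at
most [#|P| ^ (#|A| + #|B|)] injections, a related pair, and along a fixed injection
a related pair comes from [#|I| ^ (#|P| - #|A| - #|B|)] maps.  Hence related pairs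
form a constant proportion of all pairs, and so do the partners of some [t]. *)
Lemma sampling_popular_tuple (P A B I : finType)
    (rel : {ffun A -> I} -> {ffun B -> I} -> bool) :
    (0 < #|I|)%N ->
    (forall f : P -> I, exists2 g : A + B -> P, injective g &
      rel [ffun a => f (g (inl a))] [ffun b => f (g (inr b))]) ->
  exists t : {ffun A -> I}, (#|I| ^ #|B| <= #|P| ^ (#|A| + #|B|) * #|[set s | rel t s]%SET|)%N.
Proof.
move=> I_gt0 relP.
pose good := [set h : {ffun A -> I} * {ffun B -> I} | rel h.1 h.2]%SET.
pose pull (f : {ffun P -> I}) (g : {ffun A + B -> P}) :=
  ([ffun a => f (g (inl a))], [ffun b => f (g (inr b))]).
have i0 : I by case: (pickP (mem I)) I_gt0 => [//|I0]; rewrite eq_card0.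
have [g0 g0_inj _] := relP (fun=> i0).
have le_qp : (#|A| + #|B| <= #|P|)%N by rewrite -card_sum; exact: leq_card g0_inj.
have card_pull (g : {ffun A + B -> P}) : injective g ->
  (#|[set f | pull f g \in good]%SET| <=
     #|good| * #|I| ^ (#|P| - (#|A| + #|B|)))%N.
  move=> g_inj; pose O := {x : P | x \notin codom g}.
  have cardO : #|{: O}| = (#|P| - (#|A| + #|B|))%N.
    rewrite card_sig -(cardC [in codom g]) card_codom// card_sum addKn.
    by apply: eq_card.
  (* [f] is recovered from its pullback along [g] and its values off the image *)
  pose split_off f := (pull f g, [ffun x : O => f (val x)]).
  have split_off_inj : injective split_off.
    move=> f1 f2 [/ffunP e1 /ffunP e2 /ffunP e3]; apply/ffunP => x.
    have [/codomP[[a|b] ->]|xO] := boolP (x \in codom g).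
    - by have := e1 a; rewrite !ffunE.
    - by have := e2 b; rewrite !ffunE.
    - by have := e3 (exist _ x xO); rewrite !ffunE.
  rewrite -cardO -card_ffun -[#|{ffun O -> I}|]cardsT -finset.cardsX -(card_imset _ split_off_inj).
  apply/subset_leq_card/fintype.subsetP => _ /imsetP[f fg ->].
  by rewrite finset.in_setX finset.in_setT andbT; move: fg; rewrite inE.
have good_large : (#|I| ^ (#|A| + #|B|) <= #|P| ^ (#|A| + #|B|) * #|good|)%N.
  rewrite -(leq_pmul2r (_ : 0 < #|I| ^ (#|P| - (#|A| + #|B|)))%N) ?expn_gt0 ?I_gt0//.
  rewrite -expnD subnKC// -card_ffun -[#|{ffun P -> I}|]cardsT.
  pose cover := (\bigcup_(g : {ffun A + B -> P} | injectiveb g)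
                  [set f | pull f g \in good])%SET.
  have /subset_leq_card : [set: {ffun P -> I}]%SET \subset cover.
    apply/fintype.subsetP => f _; have [g g_inj relg] := relP f.
    apply/finset.bigcupP; exists (finfun g).
      by apply/injectiveP => x y; rewrite !ffunE => /g_inj.
    rewrite !inE /pull /=; move: relg.
    by congr (is_true (rel _ _)); apply/ffunP => x; rewrite !ffunE.
  move=> le_cover; apply: (leq_trans le_cover); apply: (@leq_trans
    (\sum_(g : {ffun A + B -> P} | injectiveb g) #|[set f | pull f g \in good]%SET|)).
    elim/big_rec2: cover {le_cover} => [|g m c _ le_cm]; first by rewrite cards0.
    by apply: leq_trans (leq_card_setU _ _) _; rewrite leq_add2l.
  rewrite -mulnA -[in leqRHS]card_sum -card_ffun -[leqRHS]sum_nat_const card_sum.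
  rewrite big_mkcond [leqRHS]big_mkcond; apply: leq_sum => g _ /=.
  by case: ifP => // /injectiveP; exact: card_pull.
have card_good : #|good| = (\sum_t #|[set s | rel t s]%SET|)%N.
  rewrite -sum1_card (eq_bigl (fun h => rel h.1 h.2)); last by move=> h; rewrite inE.
  rewrite -(pair_big_dep xpredT rel (fun _ _ => 1%N))/=.
  by apply: eq_bigr => t _; rewrite sum1_card cardsE.
have [t _ tmax] := @arg_maxnP _ [ffun=> i0] xpredT
  (fun t : {ffun A -> I} => #|[set s | rel t s]%SET|) isT.
exists t; rewrite -(leq_pmul2l (_ : 0 < #|I| ^ #|A|)%N) ?expn_gt0 ?I_gt0//.
rewrite -expnD (leq_trans good_large)// mulnCA leq_mul2l card_good -card_ffun.
apply/orP; right; rewrite -[leqRHS]sum_nat_const.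
by apply: leq_sum => u _; exact: tmax.
Qed.

(** Integer weights are realised by repeating each [i] as often as its weight
says; repetitions are harmless because the hypothesis concerns arbitrary, not
necessarily injective, maps [f]. *)
Lemma popular_weighted (T : Type) (P A I : finType) (Phi : {ffun A -> I} -> T)
    (cov : T -> I -> bool) :
    (forall f : P -> I, exists2 g : A + unit -> P, injective g &
      cov (Phi [ffun a => f (g (inl a))]) (f (g (inr tt)))) ->
  forall w : I -> nat, (0 < \sum_i w i)%N -> exists e : T,
    (\sum_i w i <= #|P| ^ (#|A| + 1) * \sum_(i | cov e i) w i)%N.
Proof.
move=> popular w w0; pose J := {i : I & 'I_(w i)}.
have cardJ (Q : pred I) : (\sum_(i | Q i) w i = #|[set x : J | Q (tag x)]%SET|)%N.
  rewrite -sum1_card; under [RHS]eq_bigl do rewrite inE -[Q _]andbT.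
  rewrite -(@sig_big_dep _ _ _ _ _ Q (fun _ _ => true) (fun _ _ => 1%N))/=.
  by apply: eq_bigr => i _; rewrite sum1_card card_ord.
pose rel (t : {ffun A -> J}) (s : {ffun unit -> J}) :=
  cov (Phi [ffun a => tag (t a)]) (tag (s tt)).
have J0 : (0 < #|{: J}|)%N.
  by rewrite -cardsT; move: w0; rewrite (cardJ xpredT).
have [|t] := @sampling_popular_tuple P A unit J rel J0.
  move=> f; have [g g_inj covg] := popular (fun x => tag (f x)).
  exists g => //; rewrite /rel !ffunE; congr (is_true (cov (Phi _) _)): covg.
  by apply/ffunP => a; rewrite !ffunE.
rewrite card_unit expn1 => Ht; exists (Phi [ffun a => tag (t a)]).
rewrite (cardJ xpredT) (_ : [set x : J | true]%SET = [set: J]%SET); last first.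
  by apply/setP => x; rewrite !inE.
rewrite cardsT (leq_trans Ht)// leq_mul2l; apply/orP; right.
rewrite cardJ -(card_imset _ (_ : injective (fun s : {ffun unit -> J} => s tt))).
  apply/subset_leq_card/fintype.subsetP => _ /imsetP[s sR ->].
  by move: sR; rewrite !inE.
by move=> s s' ss'; apply/ffunP => -[].
Qed.

Section reweighting.
Variables (I : finType) (T : Type) (cov : T -> I -> bool).

Definition hits (e : seq T) i := count (cov^~ i) e.

(** Each round doubles the weight of the indices that the new element misses, so
the weight of [i] after [n] rounds is [2 ^ (n - hits e i)]; as the new element
covers at least a fraction [1 / B] of the weight, the total weight grows by a
factor of at most [(2B - 1) / B]. *)
Lemma double_the_uncovered (B : nat) :
    (forall w : I -> nat, (0 < \sum_i w i)%N ->
      exists e, (\sum_i w i <= B * \sum_(i | cov e i) w i)%N) ->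
    (0 < #|I|)%N ->
  forall n, exists2 e : seq T, size e = n &
    (B ^ n * \sum_i 2 ^ (n - hits e i) <= (B.*2.-1) ^ n * #|I|)%N.
Proof.
move=> popular I_gt0; elim=> [|n [e szE IH]].
  by exists [::] => //; rewrite !mul1n (eq_bigr (fun=> 1%N)) ?sum1_card.
have [|e0 he0] := popular (fun i => 2 ^ (n - hits e i))%N.
  have [i _] : exists i : I, i \in I by apply/card_gt0P.
  by rewrite (bigD1 i)//= ltn_addr// expn_gt0.
exists (e0 :: e); first by rewrite /= szE.
pose w i := (2 ^ (n - hits e i))%N.
have hits_le i : (hits e i <= n)%N by rewrite -szE count_size.
have split_w : (\sum_i 2 ^ (n.+1 - hits (e0 :: e) i) + \sum_(i | cov e0 i) w i =
                2 * \sum_i w i)%N.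
  rewrite [X in (X + _)%N](bigID (cov e0)) [in RHS](bigID (cov e0))/=.
  have e1 : (\sum_(i | cov e0 i) 2 ^ (n.+1 - (cov e0 i + hits e i)) =
             \sum_(i | cov e0 i) w i)%N.
    by apply: eq_bigr => i ->; rewrite add1n subSS.
  have e2 : (\sum_(i | ~~ cov e0 i) 2 ^ (n.+1 - (cov e0 i + hits e i)) =
             2 * \sum_(i | ~~ cov e0 i) w i)%N.
    rewrite big_distrr/=; apply: eq_bigr => i /negbTE ->.
    by rewrite add0n subSn// expnS.
  by rewrite e1 e2; lia.
rewrite !expnS; move: IH he0 split_w; rewrite -/w.
set W := (\sum_i w i)%N; set W' := (\sum_i 2 ^ _)%N; set V := (\sum_(i | _) _)%N.
move=> IH he0 split_w.
have step : (B * W' <= (B.*2.-1) * W)%N by nia.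
nia.
Qed.

(** An index hit [h] times has weight [2 ^ (n - h)] after [n] rounds, which cannot
exceed the total weight [((2B - 1) / B) ^ n * #|I|]; for [n = 3 (2B - 1) #|I|]
this forces [h] to be at least [#|I|]. *)
Lemma fractional_cover_of_popular (B : nat) : (0 < B)%N ->
    (forall w : I -> nat, (0 < \sum_i w i)%N ->
      exists e, (\sum_i w i <= B * \sum_(i | cov e i) w i)%N) ->
    (0 < #|I|)%N ->
  exists2 e : seq T, (0 < size e)%N &
    forall i, (size e <= 6 * B * hits e i)%N.
Proof.
move=> B_gt0 popular I_gt0; pose a := B.*2.-1; pose s := (3 * a)%N.
have [e szE he] := double_the_uncovered popular I_gt0 (s * #|I|).
have a_gt0 : (0 < a)%N by rewrite /a; lia.
exists e; first by rewrite szE !muln_gt0 a_gt0.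
move=> i; have [hi|hi] := leqP #|I| (hits e i).
  by rewrite szE /s /a leq_mul//; lia.
exfalso.
(* with [a = 2B - 1], [s = 3a] rounds make [((a + 1) / a) ^ s] at least 4 *)
have bernoulli m : ((a + m) * a ^ m <= a * a.+1 ^ m)%N.
  by elim: m => [|m IHm]; rewrite ?expn0 ?addn0// !expnS; nia.
have bern4 : (4 * a ^ s <= a.+1 ^ s)%N.
  have := bernoulli s; rewrite /s (_ : (a + 3 * a = a * 4)%N) ?[(a * 4 * _)%N]mulnA//; last lia.
  by rewrite -mulnA leq_pmul2l.
have lower : (2 ^ (s * #|I| - hits e i) <= \sum_i 2 ^ (s * #|I| - hits e i))%N.
  by rewrite (bigD1 i)//= leq_addr.
have upper : ((a.+1 ^ s) ^ #|I| <= (a ^ s) ^ #|I| * (#|I| * 2 ^ hits e i))%N.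
  rewrite -!expnM (_ : a.+1 = (2 * B)%N); last by rewrite /a; lia.
  rewrite expnMn.
  have hs : (hits e i <= s * #|I|)%N by rewrite -szE count_size.
  rewrite -(subnK hs) [(2 ^ (_ + _))%N]expnD (subnK hs).
  move: (leq_trans (leq_mul (leqnn (B ^ (s * #|I|))) lower) he).
  rewrite -/a; nia.
have : ((4 ^ #|I|) * (a ^ s) ^ #|I| <= (a ^ s) ^ #|I| * (#|I| * 2 ^ hits e i))%N.
  by rewrite -expnMn (leq_trans _ upper)// leq_exp2r// .
rewrite mulnC leq_pmul2l ?expn_gt0 ?a_gt0//.
rewrite (_ : 4 = 2 * 2)%N// expnMn.
have h1 : (#|I| < 2 ^ #|I|)%N by rewrite ltn_expl.
have h2 : (2 ^ hits e i <= 2 ^ #|I|)%N by rewrite leq_exp2l// ltnW.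
have : (0 < 2 ^ #|I|)%N by rewrite expn_gt0.
nia.
Qed.
End reweighting.

(** * Convex sets: Radon, Helly and Tverberg *)

Section convexity.
Variable R : realType.

Lemma convex_setP (V : lmodType R) (K : set V) : convex_set K <->
  forall x y t, 0 <= t <= 1 -> K x -> K y -> K (t *: x + (1 - t) *: y).
Proof.
split => [cK x y t /andP[t0 t1] Kx Ky|cK x y l].
  by have := cK x y (Itv01 t0 t1); rewrite !inE; exact.
by rewrite !inE; apply: cK; rewrite ge0 le1.
Qed.

Lemma convex_setI (V : lmodType R) (K L : set V) :
  convex_set K -> convex_set L -> convex_set (K `&` L).
Proof.
move=> /convex_setP cK /convex_setP cL; apply/convex_setP => x y t t01 [? ?] [? ?].
by split; [exact: cK|exact: cL].
Qed.

Lemma convex_bigcap (V : lmodType R) (J : Type) (D : set J) (K : J -> set V) :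
  (forall j, D j -> convex_set (K j)) -> convex_set (\bigcap_(j in D) K j).
Proof.
move=> cK; apply/convex_setP => x y t t01 Kx Ky j Dj.
by move/convex_setP: (cK j Dj); apply; [|exact: Kx|exact: Ky].
Qed.

Lemma convex_combination (V : lmodType R) (J : finType) (K : set V)
    (w : J -> R) (x : J -> V) :
    convex_set K -> (forall j, 0 <= w j) -> (0 < \sum_j w j) ->
    (forall j, 0 < w j -> K (x j)) ->
  K ((\sum_j w j)^-1 *: \sum_j w j *: x j).
Proof.
move=> /convex_setP cK w0 wsum Kx.
suff : forall s : seq J, 0 < \sum_(j <- s) w j ->
    K ((\sum_(j <- s) w j)^-1 *: \sum_(j <- s) w j *: x j) by exact.
elim=> [|j s IH]; first by rewrite big_nil ltxx.
rewrite !big_cons => ws.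
have /predU1P[s0|s0] : (\sum_(i <- s) w i == 0) || (0 < \sum_(i <- s) w i).
  by rewrite eq_sym -le_eqVlt sumr_ge0.
  have -> : \sum_(i <- s) w i *: x i = 0.
    apply: big1_seq => i /andP[_ si].
    move/eqP: s0; rewrite psumr_eq0// => /allP/(_ i si)/eqP ->.
    by rewrite scale0r.
  move: ws; rewrite s0 !addr0 => wj.
  by rewrite scalerA mulVf ?gt_eqF// scale1r; exact: Kx.
have /predU1P[wj0|wj] : (w j == 0) || (0 < w j) by rewrite eq_sym -le_eqVlt.
  by rewrite wj0 scale0r !add0r; exact: IH.
set W := \sum_(i <- s) w i in ws s0 IH *.
set X := \sum_(i <- s) w i *: x i in IH *.
have -> : (w j + W)^-1 *: (w j *: x j + X) =
    (w j / (w j + W)) *: x j + (1 - w j / (w j + W)) *: (W^-1 *: X).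
  rewrite scalerDr !scalerA; congr (_ *: _ + _ *: _); first by rewrite mulrC.
  by field; rewrite !gt_eqF.
apply: cK; [|exact: Kx|exact: IH].
apply/andP; split; first by rewrite divr_ge0// ltW.
by rewrite ler_pdivrMr// mul1r lerDl ltW.
Qed.

(** The intersection of the convex supersets; this form makes hulls of hulls
trivial to handle, and convex combinations occur only in Radon's theorem. *)
Definition hull (V : lmodType R) (X : set V) : set V :=
  [set z | forall K : set V, convex_set K -> X `<=` K -> K z].

Lemma hull_sub (V : lmodType R) (X K : set V) :
  convex_set K -> X `<=` K -> hull X `<=` K.
Proof. by move=> cK XK z; apply. Qed.

Lemma sub_hull (V : lmodType R) (X : set V) : X `<=` hull X.
Proof. by move=> x Xx K _; apply. Qed.

Lemma hullS (V : lmodType R) (X Y : set V) : X `<=` Y -> hull X `<=` hull Y.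
Proof. by move=> XY z hz K cK YK; apply: hz => // x /XY/YK. Qed.

Lemma convex_hull (V : lmodType R) (X : set V) : convex_set (hull X).
Proof.
apply/convex_setP => x y t t01 hx hy K cK XK.
by move/convex_setP: (cK); apply => //; [exact: hx|exact: hy].
Qed.

(** An affine dependency exists for dimension reasons; its positive and negative
parts, normalised, are two convex combinations of the same point. *)
Lemma radon n (x : 'I_n.+2 -> 'rV[R]_n) : exists (S : {set 'I_n.+2}) z,
  hull (x @` [set` S]) z /\ hull (x @` [set` (~: S)%SET]) z.
Proof.
pose M := \matrix_(i < n.+2) row_mx (x i) (1 : 'rV[R]_1).
have /rowV0Pn[u /sub_kermxP uM u0] : kermx M != 0.
  by rewrite kermx_eq0 /row_free ltn_eqF// ltnS (leq_trans (rank_leq_col _)) ?addn1.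
have comb (i : 'I_n.+2) : row i M = row_mx (x i) 1 by rewrite rowK.
move: uM; rewrite mulmx_sum_row.
under eq_bigr do rewrite comb scale_row_mx.
move=> uM.
have sum0 : \sum_i u 0 i = 0.
  have /rowP/(_ (rshift n 0)) := uM; rewrite summxE [in RHS]mxE => e0.
  by rewrite -[RHS]e0; apply: eq_bigr => i _; rewrite row_mxEr !mxE mulr1.
have sumx0 : \sum_i u 0 i *: x i = 0.
  apply/rowP => k; have /rowP/(_ (lshift 1 k)) := uM.
  rewrite !summxE [in RHS]mxE => e0; rewrite mxE -[RHS]e0.
  by apply: eq_bigr => i _; rewrite row_mxEl.
pose S := [set i | 0 < u 0 i]%SET.
pose wp i := Num.max (u 0 i) 0; pose wn i := Num.max (- u 0 i) 0.
have wpE i : u 0 i = wp i - wn i.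
  rewrite /wp /wn; have [ui|/ltW ui] := leP 0 (u 0 i).
    by rewrite (max_r (x := - _)) ?oppr_le0// subr0.
  by rewrite (max_l (x := - _)) ?oppr_ge0// opprK add0r.
have wp0 i : 0 <= wp i by rewrite le_max lexx orbT.
have wn0 i : 0 <= wn i by rewrite le_max lexx orbT.
have sumE : \sum_i wp i = \sum_i wn i.
  by apply/eqP; rewrite -subr_eq0 -sumrB -[eqbRHS]sum0; under eq_bigr do rewrite -wpE.
have sumxE : \sum_i wp i *: x i = \sum_i wn i *: x i.
  apply/eqP; rewrite -subr_eq0 -sumrB -[eqbRHS]sumx0.
  by under eq_bigr do rewrite -scalerBl -wpE.
have sum_gt0 : 0 < \sum_i wp i.
  rewrite lt_neqAle sumr_ge0// andbT eq_sym.
  apply: contra_neq u0 => wp_sum; apply/rowP => i; rewrite mxE wpE.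
  have e1 : wp i = 0 by apply: (psumr_eq0P _ wp_sum).
  have e2 : wn i = 0 by rewrite sumE in wp_sum; apply: (psumr_eq0P _ wp_sum).
  by rewrite e1 e2 subrr.
exists S, ((\sum_i wp i)^-1 *: \sum_i wp i *: x i); split => K cK xK.
  apply: convex_combination => // i wi; apply: xK; exists i => //=.
  by move: wi; rewrite inE /wp lt_max ltxx orbF.
rewrite sumE sumxE; apply: convex_combination => //; first by rewrite -sumE.
move=> i wi; apply: xK; exists i => //=.
by move: wi; rewrite inE /wn inE lt_max ltxx orbF oppr_gt0 -leNgt => /ltW.
Qed.

(** The point given by Radon's theorem applied to the [y j] lies in every [D i]:
it is in the hull of the [y j] with [j] on the side of the partition that does
not contain [i]. *)
Lemma helly_nplus2 n (D : 'I_n.+2 -> set 'rV[R]_n) :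
    (forall i, convex_set (D i)) ->
    (forall j, exists y, forall i, i != j -> D i y) ->
  exists y, forall i, D i y.
Proof.
move=> cD /choice[y Dy]; have [S [z [zS zC]]] := radon y.
exists z => i; have [iS|iS] := boolP (i \in S).
  apply: zC => // _ [j /= jS <-]; apply: Dy.
  by move: jS; rewrite inE; apply: contraNneq => <-.
apply: zS => // _ [j /= jS <-]; apply: Dy.
by apply: contraNneq iS => ->.
Qed.

(** Iterating Radon's theorem: if [P] points always split into [k] classes with a
common hull point, take [n + 2] groups of [P] points and apply Radon's theorem to
their common points; each side of the Radon partition yields [k] classes.  The
size of [P] is far from the optimal one, but any bound will do. *)
Lemma tverberg_weak n (r : nat) : exists2 P : finType, (0 < #|P|)%N &
  forall x : P -> 'rV[R]_n, exists (col : P -> nat) z,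
    forall c, (c < r)%N -> hull (x @` [set a | col a = c]) z.
Proof.
suff : exists2 P : finType, (0 < #|P|)%N &
  forall x : P -> 'rV[R]_n, exists (col : P -> nat) z,
    forall c, (c < 2 ^ r)%N -> hull (x @` [set a | col a = c]) z.
  move=> [P P0 HP]; exists P => // x; have [col [z zP]] := HP x.
  by exists col, z => c cr; apply: zP; rewrite (ltn_trans cr)// ltn_expl.
elim: r => [|r [P P0 IH]].
  exists unit; first by rewrite card_unit.
  by move=> x; exists (fun=> 0%N), (x tt) => -[|//] _; apply: sub_hull; exists tt.
exists ('I_n.+2 * P)%type; first by rewrite card_prod card_ord muln_gt0.
move=> x; have /choice[col /choice[y colP]] i := IH (fun a => x (i, a)).
have [S [z [zS zC]]] := radon y.
pose col' (ia : 'I_n.+2 * P) :=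
  (col ia.1 ia.2 + if ia.1 \in S then 0 else 2 ^ r)%N.
exists col', z => c; rewrite expnS mul2n -addnn => cr.
have glue (T : {set 'I_n.+2}) k : (k < 2 ^ r)%N ->
    (forall i a, i \in T -> col i a = k -> col' (i, a) = c) ->
    hull (y @` [set` T]) z -> hull (x @` [set a | col' a = c]) z.
  move=> kr Tc zT; apply: zT; first exact: convex_hull.
  move=> _ [i /= iT <-]; apply: (hullS _ (colP i k kr)) => _ [a /= ak <-].
  by exists (i, a) => //=; exact: Tc.
have [clt|cge] := ltnP c (2 ^ r).
  by apply: (glue S c) => // i a iS ak; rewrite /col'/= iS addn0.
apply: (glue (~: S)%SET (c - 2 ^ r)%N) => //; first by rewrite ltn_subLR.
by move=> i a; rewrite inE /col'/= => /negbTE -> ->; rewrite subnK.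
Qed.

End convexity.

(** * Compactness and the point nearest to the origin *)

Section compactness.
Variable R : realType.

Definition sqnorm n (x : 'rV[R]_n) : R := \sum_i x ord0 i ^+ 2.

Lemma sqnorm_ge0 n (x : 'rV[R]_n) : 0 <= sqnorm x.
Proof. by apply: sumr_ge0 => i _; exact: sqr_ge0. Qed.

Lemma sqnorm_eq0 n (x : 'rV[R]_n) : sqnorm x <= 0 -> x = 0.
Proof.
move=> x0; have {}x0 : sqnorm x = 0 by apply/eqP; rewrite eq_le x0 sqnorm_ge0.
apply/rowP => i; rewrite mxE; apply/eqP; rewrite -sqrf_eq0; apply/eqP.
by apply: (psumr_eq0P _ x0) => // j _; exact: sqr_ge0.
Qed.

Lemma sqnormZ n a (x : 'rV[R]_n) : sqnorm (a *: x) = a ^+ 2 * sqnorm x.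
Proof. by rewrite mulr_sumr; apply: eq_bigr => i _; rewrite mxE exprMn. Qed.

Lemma sqr_coord_le_sqnorm n (x : 'rV[R]_n) i : x ord0 i ^+ 2 <= sqnorm x.
Proof.
by rewrite /sqnorm (bigD1 i)//= lerDl sumr_ge0// => j _; exact: sqr_ge0.
Qed.

(** Strict convexity of the Euclidean norm in the form of an identity, which
replaces the triangle and Cauchy-Schwarz inequalities throughout. *)
Lemma sqnorm_conv n (t : R) (x y : 'rV[R]_n) :
  sqnorm (t *: x + (1 - t) *: y) =
  t * sqnorm x + (1 - t) * sqnorm y - t * (1 - t) * sqnorm (x - y).
Proof.
rewrite /sqnorm !mulr_sumr -big_split -sumrB/=.
by apply: eq_bigr => i _; rewrite !mxE; ring.
Qed.

Lemma convex_sqnorm_le n s : convex_set [set x : 'rV[R]_n | sqnorm x <= s].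
Proof.
apply/convex_setP => x y t /andP[t0 t1] /= xs ys; rewrite sqnorm_conv.
have : 0 <= t * (1 - t) * sqnorm (x - y).
  by rewrite !mulr_ge0 ?subr_ge0 ?sqnorm_ge0.
nra.
Qed.

Lemma continuous_mx (T : topologicalType) m n (f : T -> 'M[R]_(m, n)) :
  (forall i j, continuous (fun t => f t i j)) -> continuous f.
Proof.
move=> cf x; apply/cvg_ballP => e e0.
have : \forall t \near x, forall ij : 'I_m * 'I_n,
    ball (f x ij.1 ij.2) e (f t ij.1 ij.2).
  apply: filter_forall => -[i j]; have /cvg_ballP := cf i j x; exact.
by apply: filterS => t ft; split => // i j; exact: (ft (i, j)).
Qed.

Lemma continuous_sum (T : topologicalType) (J : finType) (f : J -> T -> R) :
  (forall j, continuous (f j)) -> continuous (fun t => \sum_j f j t).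
Proof.
by move=> cf; apply: continuous_big => // -[x y]; apply: cvgD; [exact: cvg_fst|exact: cvg_snd].
Qed.

Lemma sqnorm_continuous n : continuous (@sqnorm n).
Proof.
apply: continuous_sum => i x.
have ci := @coord_continuous R 1 n ord0 i x; exact: (cvgM ci ci).
Qed.

Lemma closed_le_fun (T : topologicalType) (f g : T -> R) :
  continuous f -> continuous g -> closed [set t | f t <= g t].
Proof.
move=> cf cg; rewrite (_ : mkset _ = (fun t => g t - f t) @^-1` [set y | 0 <= y]).
  apply: (continuous_closedP _).1; last exact: closed_ge.
  by move=> t; apply: cvgB; [exact: cg|exact: cf].
by apply/seteqP; split => t /=; rewrite subr_ge0.
Qed.

Lemma closed_forall (T : topologicalType) (J : Type) (D : J -> set T) :
  (forall j, closed (D j)) -> closed [set t | forall j, D j t].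
Proof.
move=> cD; rewrite (_ : mkset _ = \bigcap_j D j); first exact: closed_bigI.
by apply/seteqP; split => t; [move=> tD j _|move=> tD j]; exact: tD.
Qed.

Lemma compact_of_coord_bound n (X : set 'rV[R]_n) M :
  closed X -> (forall x, X x -> forall i, `|x ord0 i| <= M) -> compact X.
Proof.
move=> clX XM; apply: bounded_closed_compact => //.
exists `|M|; split; first exact: num_real.
move=> N MN x Xx /=; rewrite (mx_normrE x : `|x| = _).
apply: bigmax_le => [|[i j] _]; first by rewrite (le_trans _ (ltW MN)).
rewrite ord1/=; apply: le_trans (XM _ Xx _) _.
by rewrite (le_trans (ler_norm M))// ltW.
Qed.

Lemma compact_coord_bound n (X : set 'rV[R]_n) :
  compact X -> exists2 M, 0 <= M & forall x, X x -> forall i, `|x ord0 i| <= M.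
Proof.
move=> /compact_bounded[M [_ XM]]; exists (`|M| + 1); first by rewrite addr_ge0.
move=> x Xx i; have := XM (`|M| + 1); rewrite ltr_pwDr ?ler_norm// => /(_ isT x Xx).
rewrite /= (mx_normrE x : `|x| = _); apply: le_trans.
have /= := @le_bigmax _ _ _ 0 (fun i : 'I_1 * 'I_n => `|x i.1 i.2|) (ord0, i).
exact.
Qed.

Lemma exists_min_sqnorm n (X : set 'rV[R]_n) : closed X -> X !=set0 ->
  exists2 x, X x & forall y, X y -> sqnorm x <= sqnorm y.
Proof.
move=> clX [x0 Xx0]; pose Y := X `&` [set x | sqnorm x <= sqnorm x0].
have cY : compact Y.
  apply: (@compact_of_coord_bound _ _ (1 + sqnorm x0)).
    apply: closedI => //; apply: closed_le_fun; first exact: sqnorm_continuous.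
    exact: cst_continuous.
  move=> x [_ /= xx0] i; have := le_trans (sqr_coord_le_sqnorm x i) xx0.
  rewrite -[_ ^+ 2]real_normK ?num_real//.
  by have := normr_ge0 (x ord0 i); have := sqnorm_ge0 x0; nra.
have [||x /set_mem[Xx xx0] xmin] := compact_EVT_min _ cY (f := @sqnorm n).
- by exists x0; split => /=.
- by apply: continuous_subspaceT; exact: sqnorm_continuous.
exists x => // y Xy; have [yx0|/ltW x0y] := leP (sqnorm y) (sqnorm x0).
  by apply: xmin; rewrite inE; split.
exact: le_trans xx0 x0y.
Qed.

Lemma min_sqnorm_unique n (X : set 'rV[R]_n) x y : convex_set X ->
  X x -> (forall y, X y -> sqnorm x <= sqnorm y) -> X y ->
  sqnorm y <= sqnorm x -> y = x.
Proof.
move=> /convex_setP cX Xx xmin Xy yx; apply/eqP; rewrite -subr_eq0; apply/eqP.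
apply: sqnorm_eq0.
have h2 : 0 <= (2^-1 : R) <= 1 by lra.
have := xmin _ (cX y x _ h2 Xy Xx).
rewrite sqnorm_conv; lra.
Qed.

Lemma nearest_to_origin_ex n : exists nearest : set 'rV[R]_n -> 'rV[R]_n,
  forall X, closed X -> X !=set0 ->
    X (nearest X) /\ forall y, X y -> sqnorm (nearest X) <= sqnorm y.
Proof.
suff /choice[f fP] : forall X : set 'rV[R]_n, exists x, closed X -> X !=set0 ->
    X x /\ forall y, X y -> sqnorm x <= sqnorm y by exists f.
move=> X.
have [[clX X0]|nX] := pselect (closed X /\ X !=set0).
  by have [x Xx xmin] := exists_min_sqnorm clX X0; exists x.
by exists 0 => clX X0; exfalso; exact: nX.
Qed.

(** A choice made once for all sets, so that the point depends on the set only: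
the counting arguments need it as a function of the bodies. *)
Definition nearest_to_origin n : set 'rV[R]_n -> 'rV[R]_n :=
  projT1 (cid (nearest_to_origin_ex n)).

Lemma nearest_to_originP n (X : set 'rV[R]_n) : closed X -> X !=set0 ->
  X (nearest_to_origin X) /\
  forall y, X y -> sqnorm (nearest_to_origin X) <= sqnorm y.
Proof. exact: (projT2 (cid (nearest_to_origin_ex n))). Qed.

(** Let [p j] be the nearest point when [D j] is dropped, and [j] the index for
which [p j] is farthest from the origin.  The [n + 1] sets [D i] together with the
part of [X] that is no farther than [p j] satisfy the hypothesis of Helly's
theorem, dropping [D i] being witnessed by [p i].  A common point is a nearest
point for [j] as well, so it equals [p j] by uniqueness. *)
Lemma one_set_redundant n (X : set 'rV[R]_n) (D : 'I_n.+1 -> set 'rV[R]_n) :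
    convex_set X -> closed X ->
    (forall i, convex_set (D i)) -> (forall i, closed (D i)) ->
    (exists x, X x /\ forall i, D i x) ->
  exists j, D j (nearest_to_origin (X `&` \bigcap_(i in [set i | i != j]) D i)).
Proof.
move=> cX clX cD clD [x0 [Xx0 Dx0]].
pose Y j := X `&` \bigcap_(i in [set i | i != j]) D i.
have clY j : closed (Y j) by apply: closedI => //; apply: closed_bigI.
have Y0 j : Y j !=set0 by exists x0; split => // i _; exact: Dx0.
have cY j : convex_set (Y j).
  by apply: convex_setI => //; apply: convex_bigcap => i _; exact: cD.
pose p j := nearest_to_origin (Y j).
have Yp j : Y j (p j) by have [] := nearest_to_originP (clY j) (Y0 j).
have pmin j : forall y, Y j y -> sqnorm (p j) <= sqnorm y.
  by have [] := nearest_to_originP (clY j) (Y0 j).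
have [j _ jmax] := @arg_maxP _ R _ ord0 xpredT (fun j => sqnorm (p j)) isT.
pose L := X `&` [set x | sqnorm x <= sqnorm (p j)].
pose D' (i : 'I_n.+2) := if unlift ord0 i is Some k then D k else L.
have [y yD'] : exists y, forall i, D' i y.
  apply: helly_nplus2 => [i|i].
    rewrite /D'; case: unlift => [k|]; first exact: cD.
    by apply: convex_setI => //; exact: convex_sqnorm_le.
  case: (unliftP ord0 i) => [k|] ->.
    exists (p k) => i'; rewrite /D'.
    case: (unliftP ord0 i') => [k'|] ->; last first.
      by move=> _; split; [case: (Yp k)|exact: jmax].
    rewrite (inj_eq lift_inj) => k'k.
    by case: (Yp k) => _; apply.
  exists x0 => i'; rewrite /D'; case: (unliftP ord0 i') => [k'|] ->.
    by move=> _; exact: Dx0.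
  by rewrite eqxx.
have [Xy yj] : L y by have := yD' ord0; rewrite /D' unlift_none.
have Dy i : D i y by have := yD' (lift ord0 i); rewrite /D' liftK.
exists j; suff -> : nearest_to_origin (Y j) = y by exact: Dy.
apply/esym/(min_sqnorm_unique (cY j) (Yp j) (pmin j)) => //.
by split => // i _; exact: Dy.
Qed.

End compactness.

(** * Weak epsilon-nets *)

Section weak_nets.
Variable R : realType.

Lemma convex_cone (V : lmodType R) (K : set V) (a b : R) x y : convex_set K ->
  0 <= a -> 0 <= b -> K x -> K y ->
  exists2 z, K z & a *: x + b *: y = (a + b) *: z.
Proof.
move=> /convex_setP cK a0 b0 Kx Ky.
have [ab0|ab0] := eqVneq (a + b) 0.
  exists x => //; have [-> ->] : a = 0 /\ b = 0 by lra.
  by rewrite addr0 !scale0r addr0.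
have ab_gt0 : 0 < a + b by rewrite lt_neqAle eq_sym ab0 addr_ge0.
exists ((a / (a + b)) *: x + (1 - a / (a + b)) *: y).
  apply: cK => //; apply/andP; split; first by rewrite divr_ge0 ?addr_ge0.
  by rewrite ler_pdivrMr// mul1r lerDl.
by rewrite scalerDr !scalerA; congr (_ *: _ + _ *: _); field.
Qed.

Lemma compact_convex_join n (X Y : set 'rV[R]_n) :
    compact X -> convex_set X -> compact Y -> convex_set Y ->
  exists Z : set 'rV[R]_n, [/\ compact Z, convex_set Z, X `<=` Z, Y `<=` Z &
    forall K : set 'rV[R]_n, convex_set K -> X `<=` K -> Y `<=` K -> Z `<=` K].
Proof.
move=> cX vX cY vY.
have [->|/set0P[x0 Xx0]] := eqVneq X set0; first by exists Y; split.
have [->|/set0P[y0 Yy0]] := eqVneq Y set0; first by exists X; split.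
pose f (p : R * ('rV[R]_n * 'rV[R]_n)) := p.1 *: p.2.1 + (1 - p.1) *: p.2.2.
exists (f @` (`[0, 1] `*` (X `*` Y))); split.
- apply: continuous_compact; last first.
    by apply: compact_setX; [exact: segment_compact|exact: compact_setX].
  apply: continuous_subspaceT => p; apply: cvgD; apply: cvgZ.
  + exact: cvg_fst.
  + by apply: (cvg_comp snd fst); [exact: cvg_snd|exact: cvg_fst].
  + by apply: cvgB; [exact: cvg_cst|exact: cvg_fst].
  + by apply: (cvg_comp snd snd); exact: cvg_snd.
- apply/convex_setP => _ _ s /andP[s0 s1] [[t [x y]] /= [t01 [Xx Yy]] <-]
    [[t' [x' y']] /= [t'01 [Xx' Yy']] <-].
  move: t01 t'01; rewrite !in_itv/= => /andP[t0 t1] /andP[t'0 t'1].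
  have s1' : 0 <= 1 - s by lra.
  have [X1 XX1 eX] := convex_cone vX (mulr_ge0 s0 t0) (mulr_ge0 s1' t'0) Xx Xx'.
  have t1' : 0 <= 1 - t by lra. have t'1' : 0 <= 1 - t' by lra.
  have [Y1 YY1 eY] := convex_cone vY (mulr_ge0 s0 t1') (mulr_ge0 s1' t'1') Yy Yy'.
  exists (s * t + (1 - s) * t', (X1, Y1)) => /=.
    by split => //; rewrite /= in_itv/=; apply/andP; split; nra.
  rewrite /f/= -eX (_ : 1 - (s * t + _) = s * (1 - t) + (1 - s) * (1 - t')); last by ring.
  by rewrite -eY -!scalerA !scalerDr addrACA.
- move=> x Xx; exists (1, (x, y0)); first by split => //=; rewrite in_itv/= ler01 lexx.
  by rewrite /f/= subrr scale1r scale0r addr0.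
- move=> y Yy; exists (0, (x0, y)); first by split => //=; rewrite in_itv/= ler01 lexx.
  by rewrite /f/= subr0 scale1r scale0r add0r.
- move=> K /convex_setP cK XK YK _ [[t [x y]] /= [t01 [Xx Yy]] <-].
  by apply: cK; [move: t01; rewrite in_itv|exact: XK|exact: YK].
Qed.

(** The sets are added one at a time: the segments joining two compact convex sets
fill a continuous image of a compact set.  Applied to finite sets of points and
to finite families of ellipsoids. *)
Lemma compact_convex_span n (J : eqType) (E : J -> set 'rV[R]_n) (s : seq J) :
    (forall j, compact (E j)) -> (forall j, convex_set (E j)) ->
  exists Z : set 'rV[R]_n, [/\ compact Z, convex_set Z, forall j, j \in s -> E j `<=` Z &
    forall K : set 'rV[R]_n, convex_set K -> (forall j, j \in s -> E j `<=` K) -> Z `<=` K].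
Proof.
move=> cE vE; elim: s => [|j s [Z [cZ vZ EZ Zmin]]].
  by exists set0; split => // [|K _ _ x //]; exact: compact0.
have [W [cW vW ZW EW Wmin]] := compact_convex_join cZ vZ (cE j) (vE j).
exists W; split => // [i|K cK EK].
  by rewrite inE => /predU1P[->//|/EZ EiZ]; exact: subset_trans ZW.
apply: Wmin => //; last by apply: EK; rewrite mem_head.
by apply: Zmin => // i si; apply: EK; rewrite inE si orbT.
Qed.

Lemma convex_set1 (V : lmodType R) (x : V) : convex_set [set x].
Proof.
by apply/convex_setP => _ _ t _ /= -> ->; rewrite -scalerDl subrKC scale1r.
Qed.

Lemma closed_hull n (J : finType) (x : J -> 'rV[R]_n) : closed (hull (range x)).
Proof.
have [Z [cZ vZ EZ Zmin]] := @compact_convex_span n J (fun j => [set x j]) (enum J)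
  (fun j => @compact_set1 _ _) (fun j => @convex_set1 _ _).
suff -> : hull (range x) = Z by exact: compact_closed.
apply/seteqP; split.
  apply: hull_sub => // _ [j _ <-]; apply: (EZ j) => //.
  by rewrite mem_enum.
apply: Zmin; first exact: convex_hull.
by move=> j _ _ ->; apply: sub_hull; exists j.
Qed.

(** First selection lemma.  Among [#|P| * (n + 1)] points, Tverberg's theorem finds
[n + 1] disjoint groups of [#|P|] points whose hulls meet, and the nearest point of
the intersection of [n] of the hulls lies in the last one.  Counting then gives
one point lying in the hull of a constant proportion of all [P]-tuples. *)
Lemma point_in_many_hulls n : exists (P : finType) (C : nat), (0 < #|P|)%N /\
  forall (I : finType) (x : I -> 'rV[R]_n), (0 < #|I|)%N ->
    exists z, (#|I| ^ #|P| <=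
      C * #|[set s : {ffun P -> I} | `[< hull (range (x \o s)) z >]]%SET|)%N.
Proof.
have [P P0 HP] := tverberg_weak R n n.+1.
pose Q := (P * 'I_n.+1)%type.
exists P, (#|{: Q}| ^ (#|{: 'I_n * P}| + #|P|))%N.
split=> // I x I0.
pose phi (t : {ffun 'I_n * P -> I}) := nearest_to_origin
  (setT `&` \bigcap_(k in [set: 'I_n]) hull (range (fun a => x (t (k, a))))).
pose rel t (s : {ffun P -> I}) : bool := `[< hull (range (x \o s)) (phi t) >].
have [|t Ht] := @sampling_popular_tuple Q _ P I rel I0; last by exists (phi t).
move=> f; have [col [z zP]] := HP (fun a => x (f (a, ord0))).
(* the colour classes all sit in column 0; swapping columns 0 and col a in
   every row a moves the class of colour j into column j *)
pose sw (a : P) (j : 'I_n.+1) : Q := (a, tperm ord0 (inord (col a)) j).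
have sw_inj a b i j : sw a i = sw b j -> a = b /\ i = j.
  by case=> <- /perm_inj <-.
pose D j := hull (range (fun a => x (f (sw a j)))).
have [|||||j Dj] := @one_set_redundant R n setT D.
- by apply/convex_setP.
- exact: closedT.
- by move=> j; exact: convex_hull.
- by move=> j; exact: closed_hull.
- exists z; split => // j; apply: hullS (zP j (ltn_ord j)) => _ [a /= aj <-].
  by exists a => //; rewrite /sw aj inord_val tpermR.
exists (fun p => match p with inl (k, a) => sw a (lift j k) | inr a => sw a j end).
  move=> [[k a]|a] [[l b]|b] /sw_inj[<-] //.
  - by move=> /lift_inj ->.
  - by move=> e; have := neq_lift j k; rewrite e eqxx.
  - by move=> e; have := neq_lift j l; rewrite -e eqxx.
have rangeE (J : Type) (g h : J -> 'rV[R]_n) : g =1 h -> range g = range h.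
  by move=> /funext ->.
apply/asboolP; rewrite /phi.
rewrite (rangeE _ _ (fun a => x (f (sw a j)))); last by move=> a /=; rewrite ffunE.
rewrite (_ : \bigcap_(k in _) _ = \bigcap_(i in [set i | i != j]) D i) //.
apply/seteqP; split => y yD i /=.
  case: (unliftP j i) => [k|] ->; last by rewrite eqxx.
  move=> _; have := yD k Logic.I.
  by rewrite (rangeE _ _ (fun a => x (f (sw a (lift j k)))))// => a; rewrite ffunE.
move=> _; have := yD (lift j i); rewrite /= eq_sym neq_lift => /(_ isT).
by rewrite (rangeE _ _ (fun a => x (f (sw a (lift j i)))))// => a; rewrite ffunE.
Qed.

(** Greedy construction: if the current [Z] misses a convex set [K] with many of
the points, some point lies in the hulls of many [P]-tuples of points of [K].
No element of [Z] lies in these hulls, as they are subsets of [K], so adding the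
point lowers the number of tuples whose hull misses [Z] by a constant
proportion of all tuples; this happens boundedly often. *)
Lemma weak_eps_net n (q : nat) : exists H : nat,
  forall (I : finType) (x : I -> 'rV[R]_n), (0 < #|I|)%N ->
  exists Z : seq 'rV[R]_n, [/\ (size Z <= H)%N,
    forall z, z \in Z -> hull (range x) z &
    forall K : set 'rV[R]_n, convex_set K ->
      (#|I| <= q * #|[set i | `[< K (x i) >]]%SET|)%N ->
      exists2 z, z \in Z & K z].
Proof.
have [P [C [P0 HP]]] := point_in_many_hulls n.
exists (C * q ^ #|P|).+1 => I x I0.
pose Hull (s : {ffun P -> I}) := hull (range (x \o s)).
pose missed (Z : seq 'rV[R]_n) :=
  [set s : {ffun P -> I} | ~~ has (fun z => `[< Hull s z >]) Z]%SET.
pose net (Z : seq 'rV[R]_n) := forall K, convex_set K ->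
  (#|I| <= q * #|[set i | `[< K (x i) >]]%SET|)%N -> exists2 z, z \in Z & K z.
have greedy k : exists Z : seq 'rV[R]_n, [/\ (size Z <= k)%N,
    forall z, z \in Z -> hull (range x) z &
    net Z \/ (C * q ^ #|P| * #|missed Z| + k * #|I| ^ #|P| <=
              C * q ^ #|P| * #|I| ^ #|P|)%N].
  elim: k => [|k [Z [szZ Zx HZ]]].
    exists [::]; split => //; right; rewrite mul0n addn0 leq_mul2l -card_ffun.
    by rewrite max_card orbT.
  have [netZ|nnetZ] := pselect (net Z).
    by exists Z; split => //; [exact: leqW|left].
  case: HZ => // HZ.
  have [K [cK Kbig Kmiss]] : exists K, [/\ convex_set K,
      (#|I| <= q * #|[set i | `[< K (x i) >]]%SET|)%N &
      forall z, z \in Z -> ~ K z].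
    move/existsNP: nnetZ => [K /not_implyP[cK /not_implyP[Kbig Kmiss]]].
    by exists K; split => // z Zz Kz; apply: Kmiss; exists z.
  pose IK := {i | i \in [set i | `[< K (x i) >]]%SET}.
  have cardIK : #|{: IK}| = #|[set i | `[< K (x i) >]]%SET| by exact: card_sig.
  have IK0 : (0 < #|{: IK}|)%N.
    by rewrite cardIK; move: (leq_trans I0 Kbig); rewrite muln_gt0 => /andP[].
  have [z zP] := HP _ (fun i : IK => x (val i)) IK0.
  set T := (X in (_ <= C * #|X|)%N) in zP.
  pose lift_s (s : {ffun P -> IK}) := [ffun a => val (s a)].
  have HullE s : Hull (lift_s s) = hull (range ((fun i : IK => x (val i)) \o s)).
    rewrite /Hull (_ : x \o lift_s s = (fun i : IK => x (val i)) \o s)//.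
    by apply/funext => a /=; rewrite ffunE.
  have lift_inj : injective lift_s.
    move=> s s' /ffunP ss; apply/ffunP => a; apply/val_inj.
    by have := ss a; rewrite !ffunE.
  have HullK s : Hull (lift_s s) `<=` K.
    apply: hull_sub => // _ [a _ <-] /=; rewrite ffunE.
    by have := valP (s a); rewrite inE => /asboolP.
  have T0 : (0 < #|T|)%N.
    have : (0 < C * #|T|)%N by rewrite (leq_trans _ zP)// expn_gt0 IK0.
    by rewrite muln_gt0 => /andP[].
  exists (z :: Z); split => //.
    move=> y; rewrite inE => /predU1P[->|]; last exact: Zx.
    have /card_gt0P[s] := T0; rewrite inE => /asboolP.
    by apply: hullS => _ [a _ <-]; exists (val (s a)).
  right.
  have mE : (#|missed (z :: Z)| + #|T| <= #|missed Z|)%N.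
    rewrite -(card_imset _ lift_inj) -(cardsID (lift_s @: T) (missed Z)) addnC.
    apply: leq_add; apply: subset_leq_card; apply/fintype.subsetP => s.
      move=> /imsetP[s' s'T ->]; rewrite !inE imset_f//= andbT.
      by apply/hasPn => y yZ; apply/asboolP => /HullK; exact: Kmiss.
    rewrite !inE /= negb_or => /andP[zs ->]; rewrite andbT.
    apply: contra zs => /imsetP[s' s'T ->]; rewrite HullE.
    by move: s'T; rewrite inE.
  have TE : (#|I| ^ #|P| <= C * q ^ #|P| * #|T|)%N.
    rewrite mulnAC; apply: (@leq_trans (q ^ #|P| * #|{: IK}| ^ #|P|)%N).
      by rewrite -expnMn leq_exp2r ?cardIK.
    by rewrite mulnC leq_mul2r zP orbT.
  nia.
have [Z [szZ Zx HZ]] := greedy (C * q ^ #|P|).+1.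
case: HZ => [netZ|]; last first.
  have : (0 < #|I| ^ #|P|)%N by rewrite expn_gt0 I0.
  by nia.
exists Z; split => //.
Qed.

End weak_nets.

(** * Orthogonal matrices and matrices in extremal position *)

Section orthogonal_matrices.
Variable R : realType.

Definition orthogonal_mx n (U : 'M[R]_n) := U *m U^T = 1%:M.

Lemma sqnormE n (x : 'rV[R]_n) : x *m x^T = (sqnorm x)%:M.
Proof.
rewrite [LHS]mx11_scalar mxE; congr (_%:M).
by apply: eq_bigr => i _; rewrite !mxE expr2.
Qed.

Lemma sqnorm_orthogonal n (U : 'M[R]_n) (x : 'rV[R]_n) :
  orthogonal_mx U -> sqnorm (x *m U) = sqnorm x.
Proof.
move=> oU; have := sqnormE (x *m U).
rewrite trmx_mul mulmxA -[x *m U *m _]mulmxA oU mulmx1 sqnormE.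
by move=> /(congr1 (fun A : 'M[R]_1 => A 0 0)); rewrite !mxE !mulr1n.
Qed.

Lemma sqnorm_delta n (i : 'I_n) : sqnorm (delta_mx 0 i : 'rV[R]_n) = 1.
Proof.
rewrite /sqnorm (bigD1 i)//= big1 => [|j ji].
  by rewrite !mxE !eqxx expr1n addr0.
by rewrite mxE (negbTE ji) andbF expr0n.
Qed.

Lemma orthogonal_mxT n (U : 'M[R]_n) : orthogonal_mx U -> orthogonal_mx U^T.
Proof. by rewrite /orthogonal_mx trmxK => /mulmx1C. Qed.

Lemma orthogonal_mxM n (U V : 'M[R]_n) :
  orthogonal_mx U -> orthogonal_mx V -> orthogonal_mx (U *m V).
Proof.
move=> oU oV; rewrite /orthogonal_mx trmx_mul mulmxA -[U *m V *m _]mulmxA oV.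
by rewrite mulmx1.
Qed.

Lemma orthogonal_mx1 n : orthogonal_mx (1%:M : 'M[R]_n).
Proof. by rewrite /orthogonal_mx trmx1 mulmx1. Qed.

Lemma orthogonal_mx_unit n (U : 'M[R]_n) : orthogonal_mx U -> U \in unitmx.
Proof. by move=> /mulmx1_unit[]. Qed.

Lemma det_orthogonal n (U : 'M[R]_n) : orthogonal_mx U -> `|\det U| = 1.
Proof.
move=> /(congr1 determinant); rewrite det_mulmx det_tr det1 => /eqP.
by rewrite -expr2 sqrf_eq1 => /orP[]/eqP ->; rewrite ?normrN normr1.
Qed.

(** The reflection in the hyperplane orthogonal to [a - b]. *)
Lemma reflection n (a b : 'rV[R]_n) : sqnorm a = sqnorm b ->
  exists2 U : 'M[R]_n, orthogonal_mx U & a *m U = b.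
Proof.
move=> ab; pose w := a - b; have [w0|w0] := eqVneq (sqnorm w) 0.
  exists 1%:M; first exact: orthogonal_mx1.
  by rewrite mulmx1; apply/eqP; rewrite -subr_eq0; apply/eqP/sqnorm_eq0; rewrite -/w w0.
have aw : a *m w^T = (sqnorm w / 2)%:M.
  rewrite [LHS]mx11_scalar mxE; congr (_%:M).
  have : \sum_i (a ord0 i ^+ 2 - b ord0 i ^+ 2) = 0.
    by rewrite sumrB; apply/eqP; rewrite subr_eq0; exact/eqP.
  have -> : \sum_i (a ord0 i ^+ 2 - b ord0 i ^+ 2) =
      2 * (\sum_i a ord0 i * w^T i ord0) - sqnorm w.
    rewrite mulr_sumr /sqnorm -sumrB; apply: eq_bigr => i _.
    by rewrite !mxE; ring.
  by move=> e; lra.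
pose W := w^T *m w; pose c := 2 / sqnorm w.
have WW : W *m W = sqnorm w *: W.
  by rewrite /W mulmxA -[w^T *m w *m w^T]mulmxA sqnormE mul_mx_scalar scalemxAl.
pose U := 1%:M - c *: W.
have UT : U^T = U by rewrite /U linearB/= linearZ/= trmx_mul trmxK trmx1.
exists U.
  rewrite /orthogonal_mx UT /U mulmxBl mul1mx mulmxBr mulmx1.
  rewrite -scalemxAl -scalemxAr WW !scalerA -!scalerBl -addrA.
  rewrite -opprD -scalerDl (_ : c + _ = 0) ?scale0r ?subr0// /c; field; exact: w0.
rewrite /U mulmxBr mulmx1 -scalemxAr mulmxA aw mul_scalar_mx scalerA.
rewrite (_ : c * _ = 1) ?scale1r ?opprB ?subrKC// /c; field; exact: w0.
Qed.

(** A reflection brings the first row to a multiple of the first basis vector;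
the remaining rows and columns are treated by induction. *)
Lemma qr_decomposition n (A : 'M[R]_n) : exists2 V : 'M[R]_n, orthogonal_mx V &
  is_trig_mx (A *m V) /\ forall i, 0 <= (A *m V) i i.
Proof.
elim: n A => [|n IH] A.
  by exists 1%:M; [exact: orthogonal_mx1|split => [|[]//]; apply/is_trig_mxP => -[]].
pose a := row ord0 A; pose s := Num.sqrt (sqnorm a).
have [|H oH aH] := @reflection _ a (s *: delta_mx 0 0).
  by rewrite sqnormZ sqr_sqrtr ?sqnorm_ge0// sqnorm_delta mulr1.
pose B : 'M[R]_(1 + n) := A *m H.
have l0 : lshift n (ord0 : 'I_1) = ord0 :> 'I_n.+1 by exact/val_inj.
have Burs : ursubmx B = 0.
  apply/matrixP => i j; rewrite ord1 !mxE.
  have /rowP/(_ (rshift 1 j)) := aH.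
  rewrite mxE [in RHS]mxE mxE andbC /= mulr0 => e.
  by rewrite -[RHS]e; apply: eq_bigr => k _; rewrite [a _ _]mxE l0.
have Buls : ulsubmx B = s%:M.
  apply/matrixP => i j; rewrite !ord1 !mxE.
  have /rowP/(_ (lshift n (ord0 : 'I_1))) := aH.
  rewrite mxE [in RHS]mxE mxE /= l0 mulr1 mulr1n => e.
  by rewrite -[RHS]e; apply: eq_bigr => k _; rewrite [a _ _]mxE.
have [V oV [tV dV]] := IH (drsubmx B).
pose V1 : 'M[R]_(1 + n) := block_mx 1%:M 0 0 V.
have oV1 : orthogonal_mx V1.
  rewrite /orthogonal_mx /V1 tr_block_mx mulmx_block !trmx0 trmx1.
  by rewrite !mulmx0 !mul0mx !mulmx1 !addr0 add0r oV -scalar_mx_block.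
have AV : B *m V1 = block_mx s%:M 0 (dlsubmx B) (drsubmx B *m V).
  rewrite -[B in LHS]submxK Burs Buls /V1 mulmx_block.
  by rewrite !mulmx0 !mul0mx !mulmx1 !addr0 add0r.
exists (H *m V1); first exact: orthogonal_mxM.
rewrite mulmxA -/B AV; split.
  suff : is_trig_mx (block_mx s%:M 0 (dlsubmx B) (drsubmx B *m V)) by exact.
  by rewrite is_trig_block_mx// eqxx tV scalar_mx_is_trig.
suff : forall i : 'I_(1 + n),
    0 <= block_mx s%:M 0 (dlsubmx B) (drsubmx B *m V) i i by exact.
move=> i; case: (split_ordP i) => i' ->.
  by rewrite block_mxEul mxE eqxx sqrtr_ge0.
by rewrite block_mxEdr.
Qed.

Lemma bernoulli_le n (t : R) : 0 <= t <= 1 -> 1 - n%:R * t <= (1 - t) ^+ n.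
Proof.
move=> /andP[t0 t1]; elim: n => [|n IH]; first by rewrite mul0r subr0 expr0.
rewrite exprS -natr1.
have : (1 - t) * (1 - n%:R * t) <= (1 - t) * (1 - t) ^+ n.
  by rewrite ler_wpM2l// subr_ge0.
have : 0 <= n%:R * t * t by rewrite !mulr_ge0.
nra.
Qed.

(** For small [t] the factor of index [i] contributes [1 + t (l i - 1)] and each
of the other [n] factors at least [1 - t], so the product exceeds 1 to first order
as soon as [l i > n + 1]. *)
Lemma diag_le_of_prod_conv_le1 n (l : 'I_n.+1 -> R) :
    (forall i, 0 <= l i) ->
    (forall t, 0 <= t <= 1 -> \prod_i ((1 - t) + t * l i) <= 1) ->
  forall i, l i <= n.+1%:R.
Proof.
move=> l0 lprod i; rewrite leNgt; apply/negP => li.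
have n0 : 0 <= n%:R :> R by rewrite ler0n.
have nS : n.+1%:R = n%:R + 1 :> R by rewrite natr1.
rewrite nS in li.
pose e := l i - (n%:R + 1); pose t := e / (2 * (n%:R + 1) * l i).
have den0 : 0 < 2 * (n%:R + 1) * l i by rewrite !mulr_gt0//; lra.
have tE : t * (2 * (n%:R + 1) * l i) = e by rewrite /t divfK// gt_eqF.
have t0 : 0 < t by rewrite divr_gt0// subr_gt0.
have tn : t * (n%:R + 1) <= 2^-1.
  rewrite -(ler_pM2r (_ : 0 < 2 * l i)); last by lra.
  rewrite (_ : _ * _ * _ = e); last by rewrite -tE; ring.
  by rewrite /e; lra.
have t01 : 0 <= t <= 1 by apply/andP; split; nra.
have := lprod t t01; rewrite (bigD1 i)//= => lp.
have low : (1 - t) ^+ n <= \prod_(j < n.+1 | j != i) (1 - t + t * l j).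
  have -> : (1 - t) ^+ n = \prod_(j < n.+1 | j != i) (1 - t).
    by rewrite prodr_const; congr (_ ^+ _); rewrite cardC1 card_ord.
  apply: ler_prod => j _; apply/andP; split; first by rewrite subr_ge0; case/andP: t01.
  by rewrite lerDl mulr_ge0// ltW.
have b := le_trans (bernoulli_le n t01) low.
have c1 : 0 <= 1 - t + t * l i by nra.
have := le_trans (ler_wpM2l c1 b) lp.
have -> : (1 - t + t * l i) * (1 - n%:R * t) =
  1 + t * (e - n%:R * (t * (l i - 1))) by rewrite /e; ring.
have h1 : n%:R * (t * (l i - 1)) <= e / 2.
  have -> : e / 2 = t * ((n%:R + 1) * l i) by rewrite -tE; field.
  rewrite mulrCA ler_wpM2l ?ltW//; nra.
have : 0 < t * (e - n%:R * (t * (l i - 1))).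
  have e0 : 0 < e by rewrite subr_gt0.
  apply: mulr_gt0 => //; lra.
lra.
Qed.

(** The hypothesis says that the unit ball has at least the volume of its image
under any convex combination of a rotation and a rotated copy of [M].  In
orthonormal bases the first of which starts with the direction of [u], [M] becomes
triangular with first diagonal entry the stretch of [u]; the determinants of the
convex combinations bound every diagonal entry by the dimension, and the product
of the entries is at least [v0]. *)
Lemma stretch_lower_bound n (M : 'M[R]_n.+1) (v0 : R) :
    0 < v0 -> v0 <= `|\det M| ->
    (forall (U V : 'M[R]_n.+1) t, orthogonal_mx U -> orthogonal_mx V ->
      0 <= t <= 1 -> `|\det ((1 - t) *: V + t *: (U *m M))| <= 1) ->
  forall u, (v0 / n.+1%:R ^+ n) ^+ 2 * sqnorm u <= sqnorm (u *m M).
Proof.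
move=> v0_gt0 v0M Mmax u; pose r := v0 / n.+1%:R ^+ n.
have [u0|u0] := eqVneq (sqnorm u) 0; first by rewrite u0 mulr0 sqnorm_ge0.
have u_gt0 : 0 < sqnorm u by rewrite lt_neqAle eq_sym u0 sqnorm_ge0.
pose s := Num.sqrt (sqnorm u); have s0 : 0 < s by rewrite sqrtr_gt0.
have s2 : s ^+ 2 = sqnorm u by rewrite sqr_sqrtr ?ltW.
(* [U] puts the direction of [u] first, [V] makes the matrix triangular *)
have [|U oU eU] := @reflection n.+1 (delta_mx 0 0) (s^-1 *: u).
  by rewrite sqnormZ exprVn s2 mulVf// sqnorm_delta.
have [V oV [tL dL]] := qr_decomposition (U *m M).
set L := U *m M *m V in tL dL.
have lprod t : 0 <= t <= 1 -> \prod_i ((1 - t) + t * L i i) <= 1.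
  move=> t01; have := Mmax U V^T t oU (orthogonal_mxT oV) t01.
  have -> : (1 - t) *: V^T + t *: (U *m M) = ((1 - t)%:M + t *: L) *m V^T.
    rewrite mulmxDl mul_scalar_mx -scalemxAl /L -[U *m M *m V *m _]mulmxA oV.
    by rewrite mulmx1.
  rewrite det_mulmx normrM (det_orthogonal (orthogonal_mxT oV)) mulr1.
  rewrite det_trig; last first.
    apply/is_trig_mxP => i j ij; rewrite mxE [_%:M i j]mxE [(t *: L) i j]mxE.
    rewrite -val_eqE ltn_eqF// mulr0n add0r.
    by move/is_trig_mxP: tL => ->; rewrite // mulr0.
  move=> /(le_trans (ler_norm _)); apply: le_trans; rewrite le_eqVlt; apply/orP; left.
  apply/eqP; apply: eq_bigr => i _.
  by rewrite [RHS]mxE [_%:M i i]mxE [(t *: L) i i]mxE eqxx mulr1n.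
have Lle := diag_le_of_prod_conv_le1 dL lprod.
have detL : `|\det M| = \prod_i L i i.
  rewrite -det_trig// -[RHS]ger0_norm; last first.
    by rewrite det_trig// prodr_ge0.
  by rewrite /L !det_mulmx !normrM (det_orthogonal oU) (det_orthogonal oV) mul1r mulr1.
have L00 : sqnorm (s^-1 *: u *m M) = L 0 0 ^+ 2.
  rewrite -(sqnorm_orthogonal _ oV) -eU -!mulmxA -rowE mulmxA.
  rewrite /sqnorm (bigD1 ord0)//= big1 ?addr0 => [|i i0].
    by rewrite mxE.
  move/is_trig_mxP: tL => tL0; rewrite mxE tL0 ?expr0n//.
  by rewrite lt0n.
have rL : r <= L 0 0.
  rewrite /r ler_pdivrMr ?exprn_gt0// (le_trans v0M)// detL big_ord_recl.
  rewrite ler_wpM2l// -[X in _ <= _ ^+ X]card_ord -prodr_const.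
  by apply: ler_prod => i _; rewrite dL Lle.
have r_gt0 : 0 < r by rewrite divr_gt0// exprn_gt0.
have -> : u *m M = s *: (s^-1 *: u *m M).
  by rewrite scalemxAl scalerA divff ?scale1r// gt_eqF.
rewrite sqnormZ L00 s2 mulrC ler_wpM2l ?sqnorm_ge0//.
by rewrite ler_pXn2r// nnegrE ?dL// ltW.
Qed.

End orthogonal_matrices.

(** * Volume of ellipsoids *)

Section ellipsoid_volume.
Local Open Scope ereal_scope.
Variable R : realType.
Notation RR := (measurableTypeR R).
Notation leb := (@lebesgue_measure R).

Lemma lebesgue_measure_affine (a b : R) (A : set RR) : (0 < a)%R ->
  measurable A -> leb A = a%:E * leb ((fun x : RR => (a * x + b)%R) @^-1` A).
Proof.
move=> a0 mA; pose f : RR -> RR := fun x => (a * x + b)%R.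
have mf : measurable_fun setT f.
  by apply: measurable_funD => //; exact: measurable_funM.
pose k : {nonneg R} := NngNum (ltW a0).
pose nu : {measure set RR -> \bar R} := mscale k (pushforward leb f).
transitivity (nu mf A); last by [].
apply: (@lebesgue_measure_unique R (nu mf) _ A mA) => _ [[u v] _ <-] /=.
rewrite /nu/= /mscale/= /pushforward/=.
rewrite (_ : f @^-1` _ = `](u - b) / a, (v - b) / a]%classic)%R; last first.
  apply/seteqP; split => x /=; rewrite !in_itv/= ltr_pdivrMr// ler_pdivlMr//;
    by rewrite /f ltrBlDr lerBrDr mulrC.
rewrite !lebesgue_measure_itv/= !lte_fin ltr_pM2r ?invr_gt0//.
rewrite ltrD2r; case: ifPn => uv; last by rewrite mule0.
by rewrite -!EFinB -EFinM; congr EFin; field; rewrite gt_eqF.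
Qed.

Lemma ge0_integral_affine (a b : R) (F : RR -> \bar R) : (0 < a)%R ->
    measurable_fun setT F -> (forall x, 0 <= F x) ->
  \int[leb]_x F x = a%:E * \int[leb]_x F (a * x + b)%R.
Proof.
move=> a0 mF F0; pose f : RR -> RR := fun x => (a * x + b)%R.
have mf : measurable_fun setT f.
  by apply: measurable_funD => //; exact: measurable_funM.
pose k : {nonneg R} := NngNum (ltW a0).
pose nu : {measure set RR -> \bar R} := mscale k (pushforward leb f).
transitivity (\int[nu mf]_x F x).
  apply: eq_measure_integral => A mA _; exact: lebesgue_measure_affine.
rewrite ge0_integral_mscale//; congr (_ * _).
by rewrite ge0_integral_pushforward.
Qed.

Definition affine_tuple n (T : 'M[R]_n) (b : 'I_n -> R) (t : n.-tuple RR) :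
  n.-tuple RR := [tuple (\sum_i tnth t i * T i j + b j)%R | j < n].

Lemma measurable_affine_tuple n (T : 'M[R]_n) b :
  measurable_fun setT (affine_tuple T b).
Proof.
apply/measurable_fun_tnthP => j.
rewrite (_ : _ \o _ = fun t => (\sum_i tnth t i * T i j + b j)%R); last first.
  by apply/funext => t /=; rewrite tnth_mktuple.
apply: measurable_funD => //; apply: measurable_sum => i.
by apply: measurable_funM => //; exact: measurable_tnth.
Qed.

(** Triangularity makes the first coordinate of the image depend on the first
coordinate of the argument only, so the change of variables follows from the
one-dimensional one by integrating over sections, which the first coordinate
merely translates. *)
Lemma lebesgue_tuple_affine n (T : 'M[R]_n) (b : 'I_n -> R)
    (S : set (n.-tuple RR)) :
    (forall i j : 'I_n, (j < i)%N -> T i j = 0%R) -> (forall i, (0 < T i i)%R) ->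
    measurable S ->
  lebesgue_tuple R n S =
  (\prod_i T i i)%:E * lebesgue_tuple R n (affine_tuple T b @^-1` S).
Proof.
elim: n T b S => [|n IH] T b S T0 Tpos mS.
  rewrite big_ord0 mul1e; congr (_ _); apply/seteqP.
  by split => t /=; rewrite (tuple0 t) (tuple0 (affine_tuple _ _ _)).
pose T' := (\matrix_(i, j) T (lift ord0 i) (lift ord0 j))%R : 'M[R]_n.
pose b' x j := (x * T ord0 (lift ord0 j) + b (lift ord0 j))%R.
pose sec (y : RR) := xsection (@cons_pair R n @^-1` S) y.
have mS' : measurable (@cons_pair R n @^-1` S).
  by rewrite -[X in measurable X]setTI; exact: measurable_cons_pair.
have secE x : xsection (@cons_pair R n @^-1` (affine_tuple T b @^-1` S)) x =
    affine_tuple T' (b' x) @^-1` (sec (T ord0 ord0 * x + b ord0)%R).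
  have affE t : affine_tuple T b (cons_pair (x, t)) =
      cons_pair ((T ord0 ord0 * x + b ord0)%R, affine_tuple T' (b' x) t).
    apply: eq_from_tnth => j; rewrite tnth_mktuple big_ord_recl tnth0.
    under eq_bigr do rewrite tnthS.
    case: (unliftP ord0 j) => [k|] ->; last first.
      rewrite tnth0 big1 ?addr0 ?[(x * _)%R]mulrC// => i _.
      by rewrite T0 ?mulr0.
    rewrite tnthS tnth_mktuple /b' -addrA [RHS]addrCA.
    congr (_ + (_ + _))%R.
    by apply: eq_bigr => i _; rewrite mxE.
  by apply/seteqP; split => t; rewrite /sec /xsection/= !inE/= affE.
have consE S' : lebesgue_tuple R n.+1 S' =
  \int[leb]_x lebesgue_tuple R n (xsection (@cons_pair R n @^-1` S') x) by [].
have msec : measurable_fun setT (fun y => lebesgue_tuple R n (sec y)).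
  exact: measurable_fun_xsection.
have T'pos i : (0 < T' i i)%R by rewrite mxE.
have prodT : (\prod_i T i i = T ord0 ord0 * \prod_i T' i i)%R.
  by rewrite big_ord_recl; congr (_ * _)%R; apply: eq_bigr => i _; rewrite mxE.
have prodT'_gt0 : (0 < \prod_i T' i i)%R by apply: prodr_gt0 => i _.
rewrite !consE (@ge0_integral_affine (T ord0 ord0) (b ord0))//.
rewrite prodT EFinM -muleA; congr (_ * _).
rewrite -ge0_integralZl//; last 2 first.
- apply: measurable_fun_xsection; rewrite -[X in measurable X]setTI.
  apply: measurable_cons_pair => //; rewrite -[X in measurable X]setTI.
  exact: measurable_affine_tuple.
- by rewrite lee_fin ltW.
apply: eq_integral => x _; rewrite secE; apply: IH => //.
- by move=> i j ij; rewrite mxE T0.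
- exact: measurable_xsection.
Qed.

End ellipsoid_volume.

Section ellipsoids_of_matrices.
Variables (R : realType) (d : nat).
Notation RR := (measurableTypeR R).
Notation ball := (@euclidean_unit_ball R d).
Implicit Types (A T U : 'M[R]_d) (b : 'rV[R]_d).

Definition ellipsoid A b : set 'rV[R]_d := [set x *m A + b | x in ball].

Definition upper_pos T :=
  (forall i j : 'I_d, (j < i)%N -> T i j = 0) /\ (forall i, 0 < T i i).

Lemma ballE (x : 'rV[R]_d) : ball x <-> sqnorm x <= 1.
Proof. by rewrite /ball/= -[X in _ <= X]sqrtr1 ler_sqrt// ltr01. Qed.

Lemma ellipsoid_orthogonal U A b : orthogonal_mx U ->
  ellipsoid (U *m A) b = ellipsoid A b.
Proof.
move=> oU; apply/seteqP; split => _ [x /ballE x1 <-].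
  exists (x *m U); first by apply/ballE; rewrite sqnorm_orthogonal.
  by rewrite mulmxA.
exists (x *m U^T); last by rewrite !mulmxA -[x *m _ *m U]mulmxA (mulmx1C oU) mulmx1.
by apply/ballE; rewrite sqnorm_orthogonal//; exact: orthogonal_mxT.
Qed.

(** As the unit ball is invariant under rotations, this lets every ellipsoid be
given by a triangular matrix with positive diagonal. *)
Lemma upper_pos_form A : A \in unitmx -> exists U T,
  [/\ orthogonal_mx U, upper_pos T & A = U *m T].
Proof.
move=> uA; have [V oV [tL dL]] := qr_decomposition A^T.
have eA : A = V *m (A^T *m V)^T.
  by rewrite trmx_mul trmxK mulmxA oV mul1mx.
have uL : A^T *m V \in unitmx.
  by rewrite unitmx_mul unitmx_tr uA orthogonal_mx_unit.
exists V, (A^T *m V)^T; split => //; split => [i j ij|i].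
  by rewrite mxE; move/is_trig_mxP: tL; apply.
rewrite mxE lt_neqAle dL andbT eq_sym.
move: uL; rewrite unitmxE det_trig// unitfE; apply: contra_neq => e.
by rewrite (bigD1 i)//= e mul0r.
Qed.

Lemma det_upper_pos T : upper_pos T -> \det T = \prod_i T i i.
Proof.
move=> [T0 _]; rewrite -det_tr det_trig; last first.
  by apply/is_trig_mxP => i j ij; rewrite mxE T0.
by apply: eq_bigr => i _; rewrite mxE.
Qed.

Lemma det_upper_pos_gt0 T : upper_pos T -> 0 < \det T.
Proof. by move=> uT; rewrite det_upper_pos//; apply: prodr_gt0 => i _; case: uT. Qed.

Lemma upper_pos_unit T : upper_pos T -> T \in unitmx.
Proof. by move=> /det_upper_pos_gt0; rewrite unitmxE unitfE => /gt_eqF ->. Qed.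

Definition ball_tuples : set (d.-tuple RR) := [set t | ball (\row_i tnth t i)].

Lemma measurable_ball_tuples : measurable ball_tuples.
Proof.
rewrite (_ : ball_tuples =
    (fun t : d.-tuple RR => \sum_i tnth t i ^+ 2) @^-1` `]-oo, 1]%classic).
  rewrite -[X in measurable X]setTI; apply: measurable_sum => // i.
  by apply: measurable_funX; exact: measurable_tnth.
have sqE (t : d.-tuple RR) : sqnorm (\row_i tnth t i) = \sum_i tnth t i ^+ 2.
  by apply: eq_bigr => i _; rewrite mxE.
apply/seteqP; split => t; rewrite /ball_tuples/= in_itv/= -sqE.
  by move/ballE.
by move=> t1; apply/ballE.
Qed.

Lemma row_affine_tuple T b (t : d.-tuple RR) :
  \row_i tnth (affine_tuple T (b ord0) t) i = (\row_i tnth t i) *m T + b.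
Proof.
apply/rowP => j; rewrite !mxE tnth_mktuple; congr (_ + _).
by apply: eq_bigr => i _; rewrite mxE.
Qed.

Lemma volume_ellipsoid_upper T b : upper_pos T ->
  volume (ellipsoid T b) = ((\det T)%:E * volume ball)%E.
Proof.
move=> uT; have [T0 Tpos] := uT; have unT := upper_pos_unit uT.
rewrite /volume det_upper_pos//.
rewrite (@lebesgue_tuple_affine _ _ T (b ord0))//; last first.
  rewrite (_ : mkset _ = affine_tuple (invmx T) ((- b *m invmx T) ord0) @^-1` ball_tuples).
    rewrite -[X in measurable X]setTI; apply: measurable_affine_tuple => //.
    exact: measurable_ball_tuples.
  apply/seteqP; split => t /=; rewrite /ball_tuples/= row_affine_tuple -mulmxDl.
    by move=> [x xB <-]; rewrite addrK mulmxK.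
  by move=> tB; exists ((\row_i tnth t i - b) *m invmx T) => //; rewrite mulmxKV// subrK.
congr (_ * _)%E; congr (lebesgue_tuple _ _ _); apply/seteqP; split => t /=.
  rewrite row_affine_tuple => -[x xB /addIr /(congr1 (mulmxr (invmx T)))].
  by rewrite /= !mulmxK// => <-.
by move=> tB; rewrite row_affine_tuple; exists (\row_i tnth t i).
Qed.

Lemma volume_ellipsoid A b : A \in unitmx ->
  volume (ellipsoid A b) = (`|\det A|%:E * volume ball)%E.
Proof.
move=> /upper_pos_form[U [T [oU uT ->]]].
rewrite ellipsoid_orthogonal// volume_ellipsoid_upper// det_mulmx normrM.
by rewrite det_orthogonal// mul1r gtr0_norm// det_upper_pos_gt0.
Qed.

Lemma measurable_box (a c : 'I_d -> R) :
  measurable [set t : d.-tuple RR | forall i, tnth t i \in `[a i, c i]].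
Proof.
rewrite [X in measurable X](_ : _ = \bigcap_(i in [set: 'I_d])
   ((fun t : d.-tuple RR => tnth t i) @^-1` `[a i, c i]%classic)); last first.
  by apply/seteqP; split => t /= tH i; [move=> _|]; exact: tH.
apply: fin_bigcap_measurable => // i _; rewrite -[X in measurable X]setTI.
by apply: (@measurable_tnth _ RR d i) => //; exact: measurable_itv.
Qed.

(** The ball contains one cube and is contained in another. *)
Lemma volume_ball : exists2 w : R, 0 < w & volume ball = w%:E.
Proof.
pose box (e : R) := [set t : d.-tuple RR | forall i, tnth t i \in `[- e, e]].
have boxE (e : R) : 0 < e -> lebesgue_tuple R d (box e) = ((e + e) ^+ d)%:E.
  move=> e0; rewrite (@lebesgue_tuple_box _ d (fun=> - e) (fun=> e)).
    by rewrite opprK prodr_const card_ord.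
  by move=> _; lra.
pose e : R := d.+1%:R^-1.
have e0 : 0 < e by rewrite invr_gt0.
have low : (((e + e) ^+ d)%:E <= volume ball)%E.
  rewrite -boxE//; apply: le_measure; rewrite ?inE.
  - exact: measurable_box.
  - exact: measurable_ball_tuples.
  move=> t te; apply/ballE; rewrite /sqnorm.
  have : \sum_(i < d) (\row_i tnth t i) ord0 i ^+ 2 <= \sum_(i < d) e.
    apply: ler_sum => i _; rewrite mxE; have := te i; rewrite in_itv/=.
    have : e <= 1 by rewrite invf_le1// ler1n.
    by nra.
  move=> /le_trans; apply; rewrite sumr_const card_ord -mulr_natl ler_pdivrMr// mul1r.
  by rewrite ler_nat.
have high : (volume ball <= ((1 + 1) ^+ d)%:E)%E.
  rewrite -boxE//; apply: le_measure; rewrite ?inE.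
  - exact: measurable_ball_tuples.
  - exact: measurable_box.
  move=> t /ballE t1 i; have := le_trans (sqr_coord_le_sqnorm _ i) t1.
  by rewrite mxE in_itv/=; nra.
exists (fine (volume ball)).
  rewrite fine_gt0// (lt_le_trans _ low) ?lte_fin ?exprn_gt0 ?addr_gt0//=.
  by rewrite (le_lt_trans high) ?ltry.
rewrite fineK// fin_numElt (lt_le_trans _ low) ?ltNyr//=.
by rewrite (le_lt_trans high) ?ltry.
Qed.

Definition ball_volume : R := fine (volume ball).

Lemma ball_volume_gt0 : 0 < ball_volume.
Proof. by rewrite /ball_volume; have [w w0 ->] := volume_ball. Qed.

Lemma volumeE A b : A \in unitmx ->
  volume (ellipsoid A b) = (`|\det A| * ball_volume)%:E.
Proof.
move=> uA; rewrite volume_ellipsoid// /ball_volume.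
by have [w w0 ->] := volume_ball; rewrite EFinM.
Qed.

End ellipsoids_of_matrices.

(** * Innermost inscribed ellipsoids *)

Section inscribed_ellipsoids.
Variables (R : realType) (d : nat).
Notation ball := (@euclidean_unit_ball R d).
Notation omega := (@ball_volume R d).
Implicit Types (A : 'M[R]_d) (b : 'rV[R]_d) (K : set 'rV[R]_d).

Lemma ball0 : ball 0.
Proof. by apply/ballE; rewrite /sqnorm big1// => i _; rewrite mxE expr0n. Qed.

Lemma ball_delta i : ball (delta_mx 0 i).
Proof. by apply/ballE; rewrite sqnorm_delta. Qed.

Lemma ellipsoid_center A b : ellipsoid A b b.
Proof. by exists 0; [exact: ball0|rewrite mul0mx add0r]. Qed.

Lemma ellipsoid_conv K A b A' b' t : convex_set K -> 0 <= t <= 1 ->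
  ellipsoid A b `<=` K -> ellipsoid A' b' `<=` K ->
  ellipsoid (t *: A + (1 - t) *: A') (t *: b + (1 - t) *: b') `<=` K.
Proof.
move=> /convex_setP cK t01 AK A'K _ [x xB <-].
have := cK _ _ t t01 (AK _ (ex_intro2 _ _ x xB erefl)) (A'K _ (ex_intro2 _ _ x xB erefl)).
by rewrite mulmxDr -!scalemxAr !scalerDr addrACA.
Qed.

Lemma ellipsoid_shrink A b l : 0 <= l <= 1 -> ellipsoid (l *: A) b `<=` ellipsoid A b.
Proof.
move=> /andP[l0 l1] _ [x /ballE xB <-]; exists (l *: x).
  apply/ballE; rewrite sqnormZ; have := sqnorm_ge0 x.
  have : l ^+ 2 <= 1 by rewrite expr_le1.
  by have := sqr_ge0 l; nra.
by rewrite -scalemxAl -scalemxAr.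
Qed.

Lemma exact_volume A v : (0 < d)%N -> 0 < v -> v <= `|\det A| * omega ->
  exists2 l, 0 < l <= 1 & `|\det (l *: A)| * omega = v.
Proof.
move=> d0 v0 vA; pose q := v / (`|\det A| * omega).
have A0 : 0 < `|\det A| * omega by exact: lt_le_trans vA.
have q0 : 0 < q by rewrite divr_gt0.
have q1 : q <= 1 by rewrite ler_pdivrMr// mul1r.
have lE : (q `^ d%:R^-1) ^+ d = q.
  by rewrite -powR_mulrn ?powR_ge0// -powRrM mulVf ?powRr1 ?ltW// pnatr_eq0 -lt0n.
exists (q `^ d%:R^-1).
  by rewrite powR_gt0//= -(@expr_le1 _ d) ?powR_ge0// lE.
rewrite detZ normrM lE gtr0_norm// /q -mulrA divfK// gt_eqF//.
Qed.

Lemma continuous_affine_point (T : topologicalType) (A : T -> 'M[R]_d)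
    (b : T -> 'rV[R]_d) (u : 'rV[R]_d) :
    (forall i j, continuous (fun t => A t i j)) ->
    (forall i j, continuous (fun t => b t i j)) ->
  continuous (fun t => u *m A t + b t).
Proof.
move=> cA cb; apply: continuous_mx => i j.
rewrite (_ : (fun t => _) = fun t => \sum_k u i k * A t k j + b t i j); last first.
  by apply/funext => t; rewrite !mxE.
move=> t; apply: cvgD; last exact: cb.
by apply: continuous_sum => k {}t; apply: cvgM; [exact: cvg_cst|exact: cA].
Qed.

Lemma closed_ellipsoid_centers A K : closed K ->
  closed [set x | ellipsoid A x `<=` K].
Proof.
move=> clK; rewrite (_ : mkset _ = [set x | forall u : {u | ball u}, K (sval u *m A + x)]).
  apply: closed_forall => u.
  have cu : continuous (fun x : 'rV[R]_d => sval u *m A + x).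
    apply: (@continuous_affine_point _ (fun=> A) id) => i j.
      exact: cst_continuous.
    exact: coord_continuous.
  exact: ((continuous_closedP _).1 cu _ clK).
apply/seteqP; split => x xK.
  by move=> [u uB]; apply: xK; exists u.
by move=> _ [u uB <-]; exact: (xK (exist _ u uB)).
Qed.

Lemma convex_ellipsoid_centers A K : convex_set K ->
  convex_set [set x | ellipsoid A x `<=` K].
Proof.
move=> cK; apply/convex_setP => x y t t01 xK yK.
have := ellipsoid_conv cK t01 xK yK.
by rewrite -scalerDl subrKC scale1r.
Qed.

(** Among the ellipsoids of volume one inside [K], this one lies in the smallest
ball around the origin; [s] is the square of the radius of that ball. *)
Definition innermost_in K (A : 'M[R]_d) (b : 'rV[R]_d) (s : R) :=
  [/\ `|\det A| * omega = 1, ellipsoid A b `<=` K,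
      ellipsoid A b `<=` [set x | sqnorm x <= s] &
      forall A' b' s', `|\det A'| * omega = 1 -> ellipsoid A' b' `<=` K ->
        ellipsoid A' b' `<=` [set x | sqnorm x <= s'] -> s <= s'].

Lemma continuous_prod (T : topologicalType) (J : finType) (f : J -> T -> R) :
  (forall j, continuous (f j)) -> continuous (fun t => \prod_j f j t).
Proof.
by move=> cf; apply: continuous_big => // -[x y]; apply: cvgM; [exact: cvg_fst|exact: cvg_snd].
Qed.

Lemma continuous_det (T : topologicalType) n (f : T -> 'M[R]_n) :
  (forall i j, continuous (fun t => f t i j)) -> continuous (fun t => \det (f t)).
Proof.
move=> cf; apply: continuous_sum => s t; apply: cvgM; first exact: cvg_cst.
exact: continuous_prod.
Qed.

(** The pairs of an inscribed ellipsoid and a bound for its squared radius form a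
compact set, on which the bound attains its minimum. *)
Lemma exists_innermost K : compact K ->
  (exists A b, `|\det A| * omega = 1 /\ ellipsoid A b `<=` K) ->
  exists A b s, innermost_in K A b s.
Proof.
move=> cK [A0 [b0 [vA0 A0K]]].
have clK := compact_closed (@norm_hausdorff _ _) cK.
have [M M0 KM] := compact_coord_bound cK.
pose s0 := d%:R * M ^+ 2.
have Ks0 x : K x -> sqnorm x <= s0.
  move=> Kx; have -> : s0 = \sum_(i < d) M ^+ 2 by rewrite sumr_const card_ord /s0 mulr_natl.
  apply: ler_sum => i _.
  by rewrite -[leLHS]real_normK ?num_real// ler_pXn2r ?nnegrE//; exact: KM.
pose P := (('rV[R]_(d * d) * 'rV[R]_d) * R)%type.
pose E (p : P) := ellipsoid (vec_mx p.1.1) p.1.2.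
pose pt (u : 'rV[R]_d) (p : P) := u *m vec_mx p.1.1 + p.1.2.
have cfst i j : continuous (fun p : P => p.1.1 i j).
  move=> p; apply: (cvg_comp (fun p : P => p.1.1) (fun m => m i j)).
    by apply: (cvg_comp fst fst); exact: cvg_fst.
  exact: coord_continuous.
have csnd i j : continuous (fun p : P => p.1.2 i j).
  move=> p; apply: (cvg_comp (fun p : P => p.1.2) (fun m => m i j)).
    by apply: (cvg_comp fst snd); [exact: cvg_fst|exact: cvg_snd].
  exact: coord_continuous.
have cvec i j : continuous (fun p : P => (vec_mx p.1.1 : 'M[R]_d) i j).
  by under eq_fun do rewrite mxE; exact: cfst.
have pt_cont u : continuous (pt u) by exact: continuous_affine_point.
pose X : set P := [set p | [/\ `|\det (vec_mx p.1.1 : 'M[R]_d)| * omega = 1, E p `<=` K,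
  E p `<=` [set x | sqnorm x <= p.2] & p.2 <= s0]].
have clX : closed X.
  rewrite (_ : X = (fun p => `|\det (vec_mx p.1.1 : 'M[R]_d)| * omega) @^-1` [set 1] `&`
      ([set p | forall u : {u | ball u}, K (pt (sval u) p)] `&`
      ([set p | forall u : {u | ball u}, sqnorm (pt (sval u) p) <= p.2] `&`
       [set p | p.2 <= s0]))); last first.
    apply/seteqP; split => [p [vp pK ps p0]|p [/= vp [pK [ps p0]]]].
      by split=> //; split=> [[u uB]|]; [apply: pK; exists u|split => // -[u uB];
        apply: ps; exists u].
    split=> // _ [u uB <-]; [exact: (pK (exist _ u uB))|exact: (ps (exist _ u uB))].
  apply: closedI.
    apply: (continuous_closedP _).1; last exact: closed_eq.
    move=> p; apply: cvgM; last exact: cvg_cst.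
    apply: cvg_norm.
    exact: (@continuous_det P d (fun p => vec_mx p.1.1) cvec p).
  apply: closedI; first by apply: closed_forall => u; exact: ((continuous_closedP _).1 (pt_cont _) _ clK).
  apply: closedI.
    apply: closed_forall => u; apply: closed_le_fun; last by move=> p; exact: cvg_snd.
    move=> p; apply: (cvg_comp (pt (sval u)) (@sqnorm R d)); first exact: pt_cont.
    exact: sqnorm_continuous.
  by apply: closed_le_fun; [move=> p; exact: cvg_snd|exact: cst_continuous].
have cX : compact X.
  pose box n (N : R) := [set x : 'rV[R]_n | forall i, `|x ord0 i| <= N].
  have cbox n N : compact (box n N).
    apply: (@compact_of_coord_bound _ _ _ N) => //; apply: closed_forall => i.
    apply: closed_le_fun; last exact: cst_continuous.
    by move=> x; exact: (cvg_norm (@coord_continuous R 1 n ord0 i x)).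
  apply: (@subclosed_compact _ X ((box (d * d)%N (M + M) `*` box d M) `*` `[0, s0])) => //.
    apply: compact_setX; last exact: segment_compact.
    by apply: compact_setX; exact: cbox.
  move=> [[m b] s] [/= _ mK ms ss0].
  have bK : K b by apply: mK; exact: ellipsoid_center.
  split; last first.
    rewrite /= in_itv/= ss0 andbT (le_trans (sqnorm_ge0 b))//.
    by apply: ms; exact: ellipsoid_center.
  split => /= [k|i]; last exact: KM.
  case/mxvec_indexP: k => i j; rewrite -[m in leLHS]vec_mxK mxvecE.
  have := KM (delta_mx 0 i *m vec_mx m + b) _ j; rewrite mxE -[in `|_|]rowE [row _ _ _ _]mxE.
  have := KM b bK j.
  have iK : K (delta_mx 0 i *m vec_mx m + b).
    by apply: mK; exists (delta_mx 0 i); [exact: ball_delta|].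
  by move=> bj /(_ iK); move: bj; rewrite !ler_norml; lra.
have [||[[m b] s] /set_mem[/= vm mK ms _] smin] := compact_EVT_min _ cX (f := snd).
- exists (mxvec A0, b0, s0); split => //=; rewrite /E/= mxvecK//.
  by move=> x /A0K /Ks0.
- by apply: continuous_subspaceT => p; exact: cvg_snd.
exists (vec_mx m), b, s; split => // A' b' s' vA' A'K A's'.
have [s'0|/ltW s0s'] := leP s' s0.
  apply: (smin (mxvec A', b', s')); rewrite inE; split => //=; rewrite ?/E/= mxvecK//.
apply: le_trans s0s'; apply: (smin (mxvec A', b', s0)); rewrite inE.
by split => //=; rewrite ?/E/= mxvecK// => x /A'K /Ks0.
Qed.

(** An ellipsoid of volume above one could be shrunk about its centre to volume
one; as the centre is in the interior of the ball of squared radius [s], the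
result would lie in a smaller ball. *)
Lemma innermost_volume_max K A b s A' b' : (0 < d)%N -> innermost_in K A b s ->
  ellipsoid A' b' `<=` K -> ellipsoid A' b' `<=` [set x | sqnorm x <= s] ->
  `|\det A'| * omega <= 1.
Proof.
move=> d0 [_ _ _ smin] A'K A's; pose i0 := Ordinal d0.
rewrite leNgt; apply/negP => vA'.
have [l /andP[l0 l1] vl] := exact_volume d0 ltr01 (ltW vA').
have {l1} l1 : l < 1.
  rewrite lt_neqAle l1 andbT; apply: contraPneq vl => ->; rewrite scale1r.
  by move=> e; rewrite e ltxx in vA'.
have unA' : A' \in unitmx.
  rewrite unitmxE unitfE; apply: contraTneq vA' => ->.
  by rewrite normr0 mul0r -leNgt ler01.
(* the centre is the midpoint of two distinct points of the ellipsoid *)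
have b's : sqnorm b' < s.
  pose w := row i0 A'.
  have w0 : 0 < sqnorm w.
    rewrite lt_neqAle sqnorm_ge0 andbT eq_sym; apply/negP => /eqP w0.
    have /sqnorm_eq0 : sqnorm w <= 0 by rewrite w0.
    rewrite /w rowE => /(congr1 (mulmxr (invmx A'))) /=.
    rewrite mulmxK// mul0mx => /rowP/(_ i0); rewrite !mxE !eqxx => /eqP.
    by rewrite oner_eq0.
  have h1 : sqnorm (w + b') <= s.
    apply: A's; exists (delta_mx 0 i0); first exact: ball_delta.
    by rewrite -rowE.
  have h2 : sqnorm (- w + b') <= s.
    apply: A's; exists (- delta_mx 0 i0).
      apply/ballE; rewrite -scaleN1r sqnormZ sqrrN expr1n mul1r; exact/ballE/ball_delta.
    by rewrite mulNmx -rowE.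
  have := sqnorm_conv 2^-1 (w + b') (- w + b').
  rewrite (_ : 1 - 2^-1 = 2^-1); last by field.
  have -> : 2^-1 *: (w + b') + 2^-1 *: (- w + b') = b'.
    by apply/rowP => j; rewrite !mxE; field.
  have -> : w + b' - (- w + b') = 2 *: w by apply/rowP => j; rewrite !mxE; ring.
  rewrite sqnormZ => ->.
  have -> : 2^-1 * 2^-1 * (2 ^+ 2 * sqnorm w) = sqnorm w by field.
  lra.
have := smin _ b' ((1 - l) * sqnorm b' + l * s) vl.
have lK : ellipsoid (l *: A') b' `<=` ellipsoid A' b'.
  by apply: ellipsoid_shrink; rewrite !ltW.
move=> /(_ (subset_trans lK A'K)) h; have : s <= (1 - l) * sqnorm b' + l * s.
  apply: h => _ [x xB <-] /=.
  have -> : x *m (l *: A') + b' = l *: (x *m A' + b') + (1 - l) *: b'.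
    by rewrite -scalemxAr scalerDr -addrA -scalerDl subrKC scale1r.
  rewrite sqnorm_conv.
  have h1 : sqnorm (x *m A' + b') <= s by apply: A's; exists x.
  have : 0 <= l * (1 - l) * sqnorm (x *m A' + b' - b').
    by rewrite !mulr_ge0 ?sqnorm_ge0 ?subr_ge0 ?ltW.
  have : l * sqnorm (x *m A' + b') <= l * s by rewrite ler_pM2l.
  lra.
nra.
Qed.

End inscribed_ellipsoids.

(** After the affine change of variables that turns the ellipsoid of maximal
volume into the unit ball, the stretch bound says that the other ellipsoid
contains a ball of radius [v0 / d^(d-1)] around its centre. *)
Lemma contains_scaled_translate (R : realType) n (Q : set 'rV[R]_n.+1)
    (A0 A1 : 'M[R]_n.+1) b0 b1 v0 :
    let omega := ball_volume R n.+1 in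
    convex_set Q -> `|\det A0| * omega = 1 ->
    (forall A b, ellipsoid A b `<=` Q -> `|\det A| * omega <= 1) ->
    ellipsoid A0 b0 `<=` Q -> ellipsoid A1 b1 `<=` Q ->
    0 < v0 -> v0 <= `|\det A1| * omega ->
  ellipsoid ((v0 / n.+1%:R ^+ n) *: A0) b1 `<=` ellipsoid A1 b1.
Proof.
move=> omega cQ vA0 Qmax A0Q A1Q v0_gt0 vA1.
have om0 : 0 < omega by exact: ball_volume_gt0.
have unA (A : 'M[R]_n.+1) : 0 < `|\det A| * omega -> A \in unitmx.
  rewrite unitmxE unitfE; apply: contraTneq => ->.
  by rewrite normr0 mul0r ltxx.
have unA0 : A0 \in unitmx by apply: unA; rewrite vA0.
have unA1 : A1 \in unitmx by apply: unA; exact: lt_le_trans vA1.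
pose M := A1 *m invmx A0.
have MA0 : M *m A0 = A1 by rewrite mulmxKV.
have detM : `|\det A1| = `|\det M| * `|\det A0| by rewrite -MA0 det_mulmx normrM.
have Mv0 : v0 <= `|\det M|.
  by move: vA1; rewrite detM -mulrA vA0 mulr1.
have := stretch_lower_bound v0_gt0 Mv0.
set r := v0 / _ => stretch.
have r0 : 0 < r by rewrite divr_gt0// exprn_gt0.
have {}stretch u : r ^+ 2 * sqnorm u <= sqnorm (u *m M).
  apply: stretch => U V t oU oV t01.
  have := @ellipsoid_conv _ _ Q (U *m A1) b1 (V *m A0) b0 t cQ t01.
  rewrite !ellipsoid_orthogonal// => /(_ A1Q A0Q) /Qmax.
  have -> : t *: (U *m A1) + (1 - t) *: (V *m A0) =
      ((1 - t) *: V + t *: (U *m M)) *m A0.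
    by rewrite mulmxDl -!scalemxAl -MA0 mulmxA addrC.
  by rewrite det_mulmx normrM -mulrA vA0 mulr1.
move=> _ [x /ballE xB <-]; exists (r *: x *m invmx M).
  apply/ballE; have := stretch (r *: x *m invmx M).
  have unM : M \in unitmx by rewrite /M unitmx_mul unA1 unitmx_inv.
  rewrite mulmxKV// sqnormZ ler_pM2l ?exprn_gt0// => h; exact: le_trans h xB.
have unM : M \in unitmx by rewrite /M unitmx_mul unA1 unitmx_inv.
by rewrite -[in LHS]MA0 mulmxA mulmxKV// -scalemxAl -scalemxAr.
Qed.

(** * One of 3d + 1 bodies is redundant *)

Section redundant_body.
Variables (R : realType) (n : nat).
Notation d := n.+1.
Notation omega := (@ball_volume R d).
Notation vec := ('rV[R]_d).
Notation shape := ('M[R]_d * 'rV[R]_d)%type.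

Lemma innermost_ex : exists innermost : set vec -> shape * R, forall K, compact K ->
  (exists A b, `|\det A| * omega = 1 /\ ellipsoid A b `<=` K) ->
  innermost_in K (innermost K).1.1 (innermost K).1.2 (innermost K).2.
Proof.
suff /choice[innermost innermostP] : forall K : set vec, exists p : shape * R, compact K ->
    (exists A b, `|\det A| * omega = 1 /\ ellipsoid A b `<=` K) ->
    innermost_in K p.1.1 p.1.2 p.2 by exists innermost.
move=> K; have [[cK eK]|nK] := pselect (compact K /\
  exists A b, `|\det A| * omega = 1 /\ ellipsoid A b `<=` K).
  by have [A [b [s innermost]]] := exists_innermost cK eK; exists ((A, b), s).
by exists ((0, 0), 0) => cK eK; exfalso; exact: nK.
Qed.

Definition innermost : set vec -> shape * R := projT1 (cid innermost_ex).

Lemma innermostP K : compact K ->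
  (exists A b, `|\det A| * omega = 1 /\ ellipsoid A b `<=` K) ->
  innermost_in K (innermost K).1.1 (innermost K).1.2 (innermost K).2.
Proof. exact: (projT2 (cid innermost_ex)). Qed.

Lemma contains_ellipsoidE (K : set vec) v : 0 < v -> contains_ellipsoid K v <->
  exists A b, `|\det A| * omega = v /\ ellipsoid A b `<=` K.
Proof.
move=> v0; split => [[E [[A [b [uA ->]]] vE EK]]|[A [b [vA AK]]]].
  by exists A, b; split => //; have := volumeE b uA; rewrite vE => -[].
have uA : A \in unitmx.
  rewrite unitmxE unitfE; apply: contraTneq v0 => e.
  by rewrite -vA e normr0 mul0r ltxx.
by exists (ellipsoid A b); split => //; [exists A, b|rewrite volumeE// vA].
Qed.

Variables (c : R).
Hypothesis c_gt0 : 0 < c.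
Hypothesis c_Helly : quantitative_Helly c.

Definition helly_volume : R := c ^+ d * d%:R `^ (- (3 * d%:R / 2)).
Definition shrink_factor : R := helly_volume / d%:R ^+ n.

Lemma helly_volume_gt0 : 0 < helly_volume.
Proof. by rewrite mulr_gt0 ?exprn_gt0// powR_gt0. Qed.

Lemma shrink_factor_gt0 : 0 < shrink_factor.
Proof. by rewrite divr_gt0 ?helly_volume_gt0// exprn_gt0. Qed.

(** The ellipsoid that 3d bodies determine: the shape is that of the innermost
ellipsoid of the first 2d of them, scaled down, and the centre is the nearest to
the origin for which it fits into all of them. *)
Definition small_ellipsoid (K : 'I_(2 * d) -> set vec) (D : 'I_d -> set vec) : shape :=
  let X := \bigcap_(k in [set: 'I_(2 * d)]) K k in
  let A := shrink_factor *: (innermost X).1.1 in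
  (A, nearest_to_origin ([set x | ellipsoid A x `<=` X] `&`
        \bigcap_(k in [set: 'I_d]) [set x | ellipsoid A x `<=` D k])).

Notation q := (3 * d + 1)%N.

(** [S] is the set of 2d indices for which the innermost ellipsoid reaches
farthest.  The intersection of any 2d bodies then contains an ellipsoid of volume
one inside the ball [H] that belongs to [S], which is what the quantitative Helly property needs
in order to be applied to the bodies and [H] together. *)
Lemma exists_redundant_body (K : 'I_q -> set vec) :
    (forall i, convex_set (K i)) -> (forall i, compact (K i)) ->
    (exists A b, `|\det A| * omega = 1 /\ forall i, ellipsoid A b `<=` K i) ->
  exists2 g : 'I_(2 * d) + 'I_d + unit -> 'I_q, injective g &
    let E := small_ellipsoid (fun k => K (g (inl (inl k))))
                             (fun k => K (g (inl (inr k)))) in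
    `|\det E.1| * omega = shrink_factor ^+ d /\ ellipsoid E.1 E.2 `<=` K (g (inr tt)).
Proof.
move=> cK kK [A0 [b0 [vA0 A0K]]].
have clK i : closed (K i) by apply: compact_closed (kK i); exact: norm_hausdorff.
pose KS (S : {set 'I_q}) := \bigcap_(i in [set` S]) K i.
have A0KS S : ellipsoid A0 b0 `<=` KS S by move=> x xE i _; exact: A0K.
have kKS (S : {set 'I_q}) : (0 < #|S|)%N -> compact (KS S).
  move=> /card_gt0P[i iS]; apply: (@subclosed_compact _ (KS S) (K i)) => //.
    by apply: closed_bigI => j _.
  by move=> x; apply.
have innS (S : {set 'I_q}) : (0 < #|S|)%N ->
    innermost_in (KS S) (innermost (KS S)).1.1 (innermost (KS S)).1.2 (innermost (KS S)).2.
  by move=> S0; apply: innermostP; [exact: kKS|exists A0, b0].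
have le_q : (2 * d <= q)%N by lia.
have [S0 S0card] : exists S0 : {set 'I_q}, #|S0| == (2 * d)%N.
  exists [set widen_ord le_q i | i in [set: 'I_(2 * d)]]%SET.
  by rewrite card_imset ?cardsT ?card_ord// => i j /(congr1 val) /= /val_inj.
have [S /eqP Scard Smax] := @arg_maxP _ R _ S0
  (fun S : {set 'I_q} => #|S| == (2 * d)%N) (fun S => (innermost (KS S)).2) S0card.
have innSS := innS S; rewrite Scard in innSS; have {}innSS := innSS isT.
set A := (innermost (KS S)).1.1 in innSS; set b := (innermost (KS S)).1.2 in innSS.
set s := (innermost (KS S)).2 in innSS Smax.
have [vA AK As Amin] := innSS.
pose H : set vec := [set x | sqnorm x <= s].
have [A1 [b1 [vA1 A1K A1H]]] : exists A1 b1,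
   [/\ helly_volume <= `|\det A1| * omega, forall i, ellipsoid A1 b1 `<=` K i &
       ellipsoid A1 b1 `<=` H].
  pose C (i : 'I_q.+1) := if unlift ord0 i is Some k then K k else H.
  have le_qS : (2 * d <= q.+1)%N by lia.
  have [|I Icard|_ [[A1 [b1 [uA1 ->]]] vE EC]] := c_Helly (ltn0Sn n) le_qS (C := C).
  - by move=> i; rewrite /C; case: unlift => [k|]; [exact: cK|exact: convex_sqnorm_le].
  - pose J := [set k | lift ord0 k \in I]%SET.
    have Jcard : ((ord0 \in I) + #|J| = 2 * d)%N.
      rewrite -Icard (cardsD1 ord0 I); congr addn.
      rewrite -(card_imset _ (@lift_inj _ ord0)); apply: eq_card => i.
      rewrite !inE; case: (unliftP ord0 i) => [k|] ->.
        by rewrite (mem_imset _ _ lift_inj) inE eq_sym neq_lift.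
      by rewrite eqxx; apply/negbTE/imsetP => -[k _ /eqP]; rewrite (negbTE (neq_lift _ _)).
    (* if [H] is one of the 2d sets, one more body completes the others to 2d bodies *)
    have [T [TJ Tcard]] : exists T : {set 'I_q}, J \subset T /\ #|T| = (2 * d)%N.
      case: (boolP (ord0 \in I)) Jcard => _; last by exists J.
      rewrite add1n => Jcard.
      have /card_gt0P[i] : (0 < #|(~: J)%SET|)%N.
        by rewrite cardsCs finset.setCK card_ord subn_gt0; lia.
      rewrite inE => iJ; exists (i |: J)%SET; split; first exact: finset.subsetUr.
      by rewrite cardsU1 iJ.
    have T0 : (0 < #|T|)%N by rewrite Tcard.
    have [vT TK Ts _] := innS T T0; have Tmax := Smax T; rewrite Tcard eqxx in Tmax.
    exists (ellipsoid (innermost (KS T)).1.1 (innermost (KS T)).1.2).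
    have uT : (innermost (KS T)).1.1 \in unitmx.
      rewrite unitmxE unitfE; apply: contra_eqN vT => /eqP ->.
      by rewrite normr0 mul0r eq_sym oner_eq0.
    split; [by exists (innermost (KS T)).1.1, (innermost (KS T)).1.2|by rewrite volumeE// vT|].
    move=> x xE i /= iI; rewrite /C; case: (unliftP ord0 i) iI => [k|] -> iI.
      by apply: TK => //=; apply: (fintype.subsetP TJ); rewrite inE.
    exact: le_trans (Ts _ xE) (Tmax isT).
  - exists A1, b1; split.
    + by move: vE; rewrite volumeE// lee_fin.
    + move=> i x /EC/(_ (lift ord0 i) Logic.I); by rewrite /C liftK.
    + by move=> x /EC/(_ ord0 Logic.I); rewrite /C unlift_none.
have Qmax A' b' : ellipsoid A' b' `<=` KS S `&` H -> `|\det A'| * omega <= 1.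
  move=> sub; apply: (innermost_volume_max _ innSS (b' := b')) => // x /sub[]//.
have cQ : convex_set (KS S `&` H).
  by apply: convex_setI; [apply: convex_bigcap => i _|exact: convex_sqnorm_le].
have A1Q : ellipsoid A1 b1 `<=` KS S `&` H.
  by move=> x xE; split; [move=> i _; exact: A1K|exact: A1H].
have AQ : ellipsoid A b `<=` KS S `&` H.
  by move=> x xE; split; [exact: AK|exact: As].
have small : ellipsoid (shrink_factor *: A) b1 `<=` ellipsoid A1 b1.
  exact: (contains_scaled_translate cQ vA Qmax AQ A1Q helly_volume_gt0 vA1).
pose e1 (k : 'I_(2 * d)) : 'I_q := enum_val (cast_ord (esym Scard) k).
have Ccard : #|(~: S)%SET| = d.+1 by rewrite cardsCs finset.setCK card_ord Scard; lia.
pose e2 (k : 'I_d.+1) : 'I_q := enum_val (cast_ord (esym Ccard) k).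
have e1S k : e1 k \in S by exact: enum_valP.
have e2S k : e2 k \notin S by have := enum_valP (cast_ord (esym Ccard) k); rewrite inE.
have e1_inj : injective e1 by move=> i j /enum_val_inj /cast_ord_inj.
have e2_inj : injective e2 by move=> i j /enum_val_inj /cast_ord_inj.
have KSE : \bigcap_(k in [set: 'I_(2 * d)]) K (e1 k) = KS S.
  apply/seteqP; split => x xK i; last by move=> _; apply: xK => /=.
  move=> /= iS; have := xK (cast_ord Scard (enum_rank_in iS i)) Logic.I.
  by rewrite /e1 cast_ordK enum_rankK_in.
have [|||||j Dj] := @one_set_redundant R d [set x | ellipsoid (shrink_factor *: A) x `<=` KS S]
   (fun k => [set x | ellipsoid (shrink_factor *: A) x `<=` K (e2 k)]).
- by apply: convex_ellipsoid_centers; apply: convex_bigcap => i _.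
- by apply: closed_ellipsoid_centers; apply: closed_bigI => i _.
- by move=> i; exact: convex_ellipsoid_centers.
- by move=> i; exact: closed_ellipsoid_centers.
- exists b1; split => [|i] x /= /small; last exact: A1K.
  by move=> xE i _; exact: A1K.
pose g (p : 'I_(2 * d) + 'I_d + unit) : 'I_q :=
  match p with inl (inl k) => e1 k | inl (inr k) => e2 (lift j k) | inr _ => e2 j end.
exists g.
  move=> [[k|k]|[]] [[l|l]|[]] //= e.
  - by rewrite (e1_inj _ _ e).
  - by have := e1S k; rewrite e (negbTE (e2S _)).
  - by have := e1S k; rewrite e (negbTE (e2S _)).
  - by have := e1S l; rewrite -e (negbTE (e2S _)).
  - by rewrite (lift_inj (e2_inj _ _ e)).
  - by have := neq_lift j k; rewrite (e2_inj _ _ e) eqxx.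
  - by have := e1S l; rewrite -e (negbTE (e2S _)).
  - by have := neq_lift j l; rewrite -(e2_inj _ _ e) eqxx.
rewrite /small_ellipsoid /= KSE -/A; split.
  rewrite detZ normrM -mulrA vA mulr1 gtr0_norm//.
  by rewrite exprn_gt0// shrink_factor_gt0.
rewrite (_ : \bigcap_(k in _) _ = \bigcap_(i in [set i | i != j])
   [set x | ellipsoid (shrink_factor *: A) x `<=` K (e2 i)]) //.
apply/seteqP; split => y yD i /=.
  case: (unliftP j i) => [k|] ->; last by rewrite eqxx.
  by move=> _; exact: (yD k).
by move=> _; apply: (yD (lift j i)); rewrite /= eq_sym neq_lift.
Qed.

End redundant_body.

(** * Weak nets of ellipsoids *)

Section assembly.
Variable R : realType.

Lemma shrink_factorX (c : R) n : shrink_factor n c ^+ n.+1 =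
  c ^+ (n.+1 ^ 2) * n.+1%:R `^ (- (5 * n.+1%:R ^+ 2 / 2) + n.+1%:R).
Proof.
have d0 : n.+1%:R != 0 :> R by rewrite pnatr_eq0.
have dS : n%:R + 1 = n.+1%:R :> R by rewrite natr1.
rewrite /shrink_factor /helly_volume -[n.+1%:R ^+ n]powR_mulrn// -mulrA -powRN.
rewrite -powRD ?d0 ?implybT// exprMn -exprM -mulnn; congr (_ * _).
rewrite -powR_mulrn ?powR_ge0// -powRrM; congr (_ `^ _).
by rewrite -dS; field.
Qed.

(** Concavity of the logarithm. *)
Lemma prod_conv_ge n (a b : 'I_n -> R) t m : 0 < m -> 0 <= t <= 1 ->
    (forall i, 0 < a i) -> (forall i, 0 < b i) ->
    m <= \prod_i a i -> m <= \prod_i b i ->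
  m <= \prod_i (t * a i + (1 - t) * b i).
Proof.
move=> m0 /andP[t0 t1] a0 b0 ma mb.
have prodE (u : 'I_n -> R) : (forall i, 0 < u i) -> \prod_i u i = expR (\sum_i ln (u i)).
  by move=> u0; rewrite expR_sum; apply: eq_bigr => i _; rewrite lnK// posrE.
have c0 i : 0 < t * a i + (1 - t) * b i.
  have [->|tn0] := eqVneq t 0; first by rewrite mul0r add0r subr0 mul1r.
  have tp : 0 < t by rewrite lt_neqAle eq_sym tn0.
  by have := a0 i; have := b0 i; nra.
have ln_m (u : 'I_n -> R) : (forall i, 0 < u i) -> m <= \prod_i u i ->
    ln m <= \sum_i ln (u i).
  by move=> u0 mu; rewrite -ler_expR lnK ?posrE// -prodE.
rewrite prodE// -[m]lnK ?posrE// ler_expR.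
apply: (@le_trans _ _ (\sum_i (t * ln (a i) + (1 - t) * ln (b i)))).
  rewrite big_split/= -!mulr_sumr.
  by have := ln_m _ a0 ma; have := ln_m _ b0 mb; nra.
apply: ler_sum => i _; exact: (@concave_ln R (Itv01 t0 t1) _ _ (a0 i) (b0 i)).
Qed.

Section parameters.
Variable d : nat.
Notation omega := (@ball_volume R d).
Notation shape := ('M[R]_d * 'rV[R]_d)%type.
Implicit Types z : 'rV[R]_(d * d + d).

Definition mat_of z : 'M[R]_d := vec_mx (lsubmx z).
Definition center_of z : 'rV[R]_d := rsubmx z.

(** The determinant of a triangular matrix is the product of its diagonal, and
products of positive numbers have convex superlevel sets. *)
Lemma convex_upper_pos m : 0 < m ->
  convex_set [set z | upper_pos (mat_of z) /\ m <= \det (mat_of z)].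
Proof.
move=> m0; apply/convex_setP => z y t t01 [[z0 zpos] mz] [[y0 ypos] my].
have E i j : mat_of (t *: z + (1 - t) *: y) i j =
    t * mat_of z i j + (1 - t) * mat_of y i j.
  by rewrite /mat_of !mxE.
have cpos i : 0 < t * mat_of z i i + (1 - t) * mat_of y i i.
  have := zpos i; have := ypos i; case/andP: t01 => t0 t1.
  have [->|tn0] := eqVneq t 0; first by rewrite mul0r add0r subr0 mul1r.
  have tp : 0 < t by rewrite lt_neqAle eq_sym tn0.
  by nra.
have up : upper_pos (mat_of (t *: z + (1 - t) *: y)).
  by split => [i j ij|i]; rewrite E// z0// y0// !mulr0 addr0.
split => //; rewrite det_upper_pos//; under eq_bigr do rewrite E.
by rewrite !det_upper_pos// in mz my; exact: prod_conv_ge.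
Qed.

Lemma convex_parameters (K : set 'rV[R]_d) : convex_set K ->
  convex_set [set z | ellipsoid (mat_of z) (center_of z) `<=` K].
Proof.
move=> cK; apply/convex_setP => z y t t01 zK yK.
have := ellipsoid_conv cK t01 zK yK.
rewrite (_ : t *: _ + _ = mat_of (t *: z + (1 - t) *: y)); last first.
  by apply/matrixP => i j; rewrite !mxE.
rewrite (_ : t *: _ + _ = center_of (t *: z + (1 - t) *: y))//.
by apply/rowP => i; rewrite !mxE.
Qed.

(** A weak epsilon-net for the parameters; its points are in the hull of the given
ones and so have determinant large enough to be scaled down to volume [v]. *)
Lemma ellipsoid_weak_net s : (0 < d)%N -> exists H : nat,
  forall (v : R) (e : seq shape), 0 < v -> (0 < size e)%N ->
    (forall x, x \in e -> `|\det x.1| * omega = v) ->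
  exists Z : seq shape, [/\ (size Z <= H)%N,
    forall x, x \in Z -> `|\det x.1| * omega = v &
    forall K : set 'rV[R]_d, convex_set K ->
      (size e <= s * count (fun x => `[< ellipsoid x.1 x.2 `<=` K >]) e)%N ->
      exists2 x, x \in Z & ellipsoid x.1 x.2 `<=` K].
Proof.
move=> d0; have [H HP] := weak_eps_net R (d * d + d) s.
exists H => v e v0 e0 ev; have om0 : 0 < omega by exact: ball_volume_gt0.
pose m := v / omega; have m0 : 0 < m by rewrite divr_gt0.
have upper (x : shape) : x \in e -> exists z, [/\ upper_pos (mat_of z),
    m <= \det (mat_of z) & ellipsoid (mat_of z) (center_of z) = ellipsoid x.1 x.2].
  move=> xe; have vx := ev x xe.
  have ux : x.1 \in unitmx.
    rewrite unitmxE unitfE; apply: contraTneq v0 => h.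
    by rewrite -vx h normr0 mul0r ltxx.
  have [U [T [oU uT xE]]] := upper_pos_form ux.
  exists (row_mx (mxvec T) x.2); rewrite /mat_of /center_of row_mxKl row_mxKr mxvecK.
  split => //; last by rewrite xE ellipsoid_orthogonal.
  rewrite /m -vx mulfK ?gt_eqF// xE det_mulmx normrM det_orthogonal// mul1r.
  by rewrite gtr0_norm// det_upper_pos_gt0.
have /choice[z zP] (k : 'I_(size e)) := upper _ (mem_nth (0, 0) (ltn_ord k)).
have [|Z [szZ Zhull Znet]] := HP _ z; first by rewrite card_ord.
have Zup y : y \in Z -> upper_pos (mat_of y) /\ m <= \det (mat_of y).
  move=> /Zhull yZ; apply: (hull_sub (convex_upper_pos m0) _ yZ).
  by move=> _ [k _ <-]; have [] := zP k.
have shrink y : exists l : R, y \in Z -> 0 < l <= 1 /\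
    `|\det (l *: mat_of y)| * omega = v.
  have [yZ|yZ] := boolP (y \in Z); last by exists 0.
  have [uy my] := Zup y yZ.
  have [|l l01 vl] := @exact_volume R d (mat_of y) v d0 v0; last by exists l.
  by rewrite -ler_pdivrMr// (le_trans my)// ler_norm.
have /choice[l lP] := shrink.
exists [seq (l y *: mat_of y, center_of y) | y <- Z]; split.
- by rewrite size_map.
- by move=> _ /mapP[y yZ ->] /=; have [] := lP y yZ.
- move=> K cK big; have [|y yZ yK] := Znet _ (convex_parameters cK).
    rewrite card_ord (leq_trans big)// leq_mul2l; apply/orP; right.
    rewrite -sum1_count (big_nth (0, 0)) big_mkord sum1_card.
    apply: subset_leq_card; apply/fintype.subsetP => k; rewrite !inE.
    by move=> /asboolP kK; apply/asboolP; have [_ _] := zP k => /= ->.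
  exists (l y *: mat_of y, center_of y); first by apply/mapP; exists y.
  have [/andP[l0 l1] _] := lP y yZ.
  by apply: subset_trans yK; apply: ellipsoid_shrink; rewrite ltW.
Qed.

End parameters.

Lemma compact_ellipsoid d (A : 'M[R]_d) b : compact (ellipsoid A b).
Proof.
apply: continuous_compact.
  apply: continuous_subspaceT.
  apply: continuous_mx => i j.
  rewrite (_ : (fun x => _) = fun x : 'rV[R]_d => \sum_k x i k * A k j + b i j).
    have h : continuous (fun x : 'rV[R]_d => \sum_k x i k * A k j).
      apply: continuous_sum => k x.
      exact: (cvgM (@coord_continuous R 1 d i k x) (cvg_cst (A k j))).
    by move=> x; exact: (cvgD (h x) (cvg_cst (b i j))).
  by apply/funext => x; rewrite !mxE.
rewrite (_ : @euclidean_unit_ball R d = [set x : 'rV[R]_d | sqnorm x <= 1]).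
  apply: (@compact_of_coord_bound _ _ _ 1).
    apply: closed_le_fun; [exact: sqnorm_continuous|exact: cst_continuous].
  move=> x /= x1 i; have := le_trans (sqr_coord_le_sqnorm x i) x1.
  by rewrite ler_norml; nra.
by apply/seteqP; split => x /ballE.
Qed.

Lemma convex_ellipsoid d (A : 'M[R]_d) b : convex_set (ellipsoid A b).
Proof.
apply/convex_setP => _ _ t t01 [x /ballE xB <-] [y /ballE yB <-].
exists (t *: x + (1 - t) *: y).
  apply/ballE; have /convex_setP h := @convex_sqnorm_le R d 1; exact: h.
rewrite mulmxDl -!scalemxAl !scalerDr addrACA -scalerDl subrKC scale1r//.
Qed.

(** Passage from subfamilies to tuples with repetitions: among [p * q] indices
either one body occurs [q] times, and it contains an ellipsoid of volume one by
itself, or at least [p] different bodies occur. *)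
Lemma indexed_pq_property d (I : finType) (K : I -> set 'rV[R]_d) p q :
    (0 < p)%N -> (0 < q)%N -> injective K -> (forall i, contains_ellipsoid (K i) 1) ->
    (forall F, F `<=` range K -> (F #= `I_p)%card ->
      exists G, [/\ G `<=` F, (G #= `I_q)%card &
        contains_ellipsoid (\bigcap_(L in G) L) 1]) ->
  forall f : 'I_(p * q) -> I, exists2 h : 'I_q -> 'I_(p * q), injective h &
    contains_ellipsoid (\bigcap_(k in [set: 'I_q]) K (f (h k))) 1.
Proof.
move=> p0 q0 K_inj K1 pq f; pose fib i := [set x | f x == i]%SET.
have [[i qi]|small] := pselect (exists i, (q <= #|fib i|)%N).
  exists (fun k => enum_val (widen_ord qi k)).
    by move=> k l /enum_val_inj /(congr1 val) /= /val_inj.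
  have fE k : f (enum_val (widen_ord qi k)) = i.
    by have := enum_valP (widen_ord qi k); rewrite inE => /eqP.
  have [E [eE vE EK]] := K1 i; exists E; split => // x Ex k _; rewrite fE.
  exact: EK.
pose Im := [set f x | x : 'I_(p * q)]%SET.
have leIm : (p <= #|Im|)%N.
  rewrite leqNgt; apply/negP => Imp.
  have : (p * q <= #|Im| * q.-1)%N.
    rewrite -[X in (X <= _)%N]card_ord -[#|'I_(p * q)|]sum1_card (partition_big f (mem Im))/=.
      rewrite -sum_nat_const; apply: leq_sum => i _; rewrite sum1_card.
      rewrite -ltnS; apply: (@leq_trans q); last by rewrite leqSpred.
      rewrite ltnNge; apply/negP => qi; apply: small; exists i.
      by rewrite (leq_trans qi)// subset_leq_card//; apply/fintype.subsetP => x; rewrite !inE.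
    by move=> x _; rewrite imset_f.
  by nia.
have [i0 _] : exists i, i \in Im by apply/card_gt0P; exact: leq_trans leIm.
pose s := take p (enum Im).
have s_size : size s = p by rewrite size_takel// -cardE.
have s_uniq : uniq s by rewrite take_uniq// enum_uniq.
have F_card : (K @` [set` s] #= `I_p)%card.
  rewrite card_eq_sym; apply/card_set_bijP; exists (fun k => K (nth i0 s k)); split.
  - by move=> k /= kp; exists (nth i0 s k) => //=; rewrite mem_nth// s_size.
  - move=> k l; rewrite !inE/= => kp lp /K_inj /eqP.
    by rewrite nth_uniq ?s_size// => /eqP.
  - move=> _ [i /= si <-]; exists (index i s); rewrite ?nth_index//=.
    by rewrite -s_size index_mem.
have [|G [GF Gq EG]] := pq (K @` [set` s]) _ F_card.
  by move=> _ [i _ <-]; exists i.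
have /card_set_bijP[u [uG u_inj u_surj]] : (`I_q #= G)%card by rewrite card_eq_sym.
have /choice[h hP] : forall k : 'I_q, exists x, u k = K (f x).
  move=> k; have /GF[i /= si <-] := uG _ (ltn_ord k).
  have /imsetP[x _ ->] : i \in Im by rewrite -mem_enum; exact: mem_take si.
  by exists x.
exists h.
  move=> k l hkl; apply/val_inj; apply: u_inj; rewrite ?hP ?hkl//; apply/mem_set;
    exact: ltn_ord.
have -> // : \bigcap_(k in [set: 'I_q]) K (f (h k)) = \bigcap_(L in G) L.
apply/seteqP; split => x xK.
  by move=> L /u_surj[k /= kq <-]; have := xK (Ordinal kq) Logic.I; rewrite -hP.
by move=> k _; rewrite -hP; apply: (xK (u k)); apply: uG => /=.
Qed.

End assembly.

(** * Bounded transversals *)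

(** The proportion [1 / B] of bodies that contain a popular ellipsoid depends on
the dimension and on [p] only, and so does the size of the weak net. *)
Lemma indexed_transversal (R : realType) (c : R) (n p : nat) :
    0 < c -> quantitative_Helly c -> (3 * n.+1 + 1 <= p)%N ->
  exists H : nat, forall (I : finType) (K : I -> set 'rV[R]_n.+1),
    injective K -> (forall i, convex_set (K i)) ->
    (forall i, contains_ellipsoid (K i) 1) ->
    (forall F, F `<=` range K -> (F #= `I_p)%card ->
      exists G, [/\ G `<=` F, (G #= `I_(3 * n.+1 + 1))%card &
        contains_ellipsoid (\bigcap_(L in G) L) 1]) ->
  exists Z : seq ('M[R]_n.+1 * 'rV[R]_n.+1), [/\ (size Z <= H)%N,
    forall E, E \in Z ->
      `|\det E.1| * ball_volume R n.+1 = shrink_factor n c ^+ n.+1 &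
    forall i, exists2 E, E \in Z & ellipsoid E.1 E.2 `<=` K i].
Proof.
move=> c_gt0 c_Helly p_ge.
set q := (3 * n.+1 + 1)%N in p_ge *.
set v := shrink_factor n c ^+ n.+1.
have v0 : 0 < v by rewrite exprn_gt0// shrink_factor_gt0.
pose A := ('I_(2 * n.+1) + 'I_n.+1)%type; pose B := (#|'I_(p * q)| ^ (#|{: A}| + 1))%N.
have p0 : (0 < p)%N by rewrite (leq_trans _ p_ge)// addn1.
have q0 : (0 < q)%N by rewrite /q addn1.
have B0 : (0 < B)%N by rewrite expn_gt0 card_ord muln_gt0 p0 q0.
have [H HP] := ellipsoid_weak_net R (6 * B) (ltn0Sn n).
exists H => I K K_inj Kconv Kvol Kpq.
have [I0|I0] := posnP #|I|.
  exists [::]; split => // i.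
  by have := fintype0 i I0.
have tuples (f : 'I_(p * q) -> I) : exists2 h : 'I_q -> 'I_(p * q), injective h &
    contains_ellipsoid (\bigcap_(k in [set: 'I_q]) K (f (h k))) 1.
  exact: (indexed_pq_property p0 q0 K_inj Kvol Kpq).
pose omega := ball_volume R n.+1.
pose good (h : {ffun 'I_q -> I}) (E : 'M[R]_n.+1 * 'rV[R]_n.+1) :=
  `|\det E.1| * omega = 1 /\ forall k, ellipsoid E.1 E.2 `<=` K (h k).
(* [K' i] is the hull of the witnesses inside [K i]: compact, and still in good
   position wherever the original bodies are *)
have /choice[w wP] : forall h, exists E, (exists E', good h E') -> good h E.
  move=> h; have [[E gE]|nE] := pselect (exists E', good h E'); first by exists E.
  by exists (0, 0) => E'; exfalso; exact: nE.
pose witnesses i := [seq h <- enum {: {ffun 'I_q -> I}} |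
   `[< good h (w h) >] && [exists k, h k == i]].
have /choice[K' K'P] := fun i : I => @compact_convex_span R n.+1 _
  (fun h => ellipsoid (w h).1 (w h).2) (witnesses i)
  (fun h => @compact_ellipsoid R _ _ _) (fun h => @convex_ellipsoid R _ _ _).
have K'K i : K' i `<=` K i.
  have [_ _ _ K'min] := K'P i; apply: K'min.
    exact: Kconv.
  move=> h; rewrite mem_filter => /andP[/andP[/asboolP[_ hK] /existsP[k /eqP <-]] _].
  exact: hK.
pose cov (E : 'M[R]_n.+1 * 'rV[R]_n.+1) (i : I) : bool :=
  `[< `|\det E.1| * omega = v /\ ellipsoid E.1 E.2 `<=` K' i >].
pose Phi (t : {ffun A -> I}) := small_ellipsoid c
  (fun k => K' (t (inl k))) (fun k => K' (t (inr k))).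
have popular (f : 'I_(p * q) -> I) : exists2 g : A + unit -> 'I_(p * q), injective g &
    cov (Phi [ffun a => f (g (inl a))]) (f (g (inr tt))).
  have [h h_inj /contains_ellipsoidE[//|E [b [vE EK]]]] := tuples f.
  pose fh := [ffun k => f (h k)].
  have gw : good fh (w fh).
    apply: wP; exists (E, b); split => // k x xE; rewrite ffunE.
    exact: (EK x xE k).
  have [||| g g_inj [vg gK]] := exists_redundant_body c_gt0 c_Helly (K := fun k => K' (f (h k))).
  - by move=> k; have [] := K'P (f (h k)).
  - by move=> k; have [] := K'P (f (h k)).
  - exists (w fh).1, (w fh).2; split; first by case: gw.
    move=> k; have [_ _ wK _] := K'P (f (h k)); apply: wK.
    rewrite mem_filter mem_enum andbT; apply/andP; split; first exact/asboolP.
    by apply/existsP; exists k; rewrite ffunE.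
  exists (h \o g); first exact: inj_comp.
  apply/asboolP; rewrite /Phi.
  rewrite (_ : (fun k => K' _) = fun k => K' (f (h (g (inl (inl k)))))); last first.
    by apply/funext => k; rewrite ffunE.
  rewrite (_ : (fun k => K' ([ffun a => _] _)) = fun k => K' (f (h (g (inl (inr k)))))); last first.
    by apply/funext => k; rewrite ffunE.
  by [].
have [e e0 ecov] := fractional_cover_of_popular B0 (popular_weighted popular) I0.
pose e' := [seq E <- e | `[< `|\det E.1| * omega = v >]].
have ecov' i : (size e' <= 6 * B * count (fun E => `[< ellipsoid E.1 E.2 `<=` K' i >]) e')%N.
  apply: leq_trans (leq_trans (ecov i) _).
    by rewrite size_filter count_size.
  rewrite leq_mul2l; apply/orP; right; rewrite count_filter /hits.
  by apply: sub_count => E /asboolP[vE EK] /=; apply/andP; split; exact/asboolP.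
have [Z [szZ vZ netZ]] : exists Z : seq ('M[R]_n.+1 * 'rV[R]_n.+1), [/\ (size Z <= H)%N,
    forall E, E \in Z -> `|\det E.1| * omega = v &
    forall L : set 'rV[R]_n.+1, convex_set L ->
      (size e' <= 6 * B * count (fun E => `[< ellipsoid E.1 E.2 `<=` L >]) e')%N ->
      exists2 E, E \in Z & ellipsoid E.1 E.2 `<=` L].
  apply: HP => //; last by move=> E; rewrite mem_filter => /andP[/asboolP].
  have /card_gt0P[i _] := I0.
  have : (0 < hits cov e i)%N.
    by have := leq_trans e0 (ecov i); rewrite muln_gt0 => /andP[].
  rewrite /hits -!has_count => /hasP[E Ee /asboolP[vE _]].
  rewrite size_filter -has_count; apply/hasP; exists E => //; exact/asboolP.
exists Z; split => // i; have [_ vK' _ _] := K'P i.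
have [E EZ EK] := netZ _ vK' (ecov' i).
by exists E => //; exact: subset_trans (K'K i).
Qed.

Theorem theorem1p7 (R : realType) (c : R) (c_gt0 : 0 < c)
    (c_Helly : quantitative_Helly c) (d p : nat)
    (d_ge1 : (1 <= d)%N) (p_ge : (3 * d + 1 <= p)%N) :
  exists H : nat, forall C : set (set 'rV[R]_d),
    finite_set C ->
    (forall K, C K -> convex_set K) ->
    (forall K, C K -> contains_ellipsoid K 1) ->
    (forall F, F `<=` C -> (F #= `I_p)%card ->
      exists G, [/\ G `<=` F, (G #= `I_(3 * d + 1))%card &
        contains_ellipsoid (\bigcap_(K in G) K) 1]) ->
    (transversal_number C
       (c ^+ (d ^ 2) * d%:R `^ (- (5 * d%:R ^+ 2 / 2) + d%:R))
     <= H%:R%:E)%E.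
Proof.
case: d d_ge1 p_ge => // n _ p_ge; rewrite -shrink_factorX.
have [H HP] := indexed_transversal c_gt0 c_Helly p_ge.
exists H => C [N]; rewrite card_eq_sym => /card_set_bijP[u [uC u_inj u_surj]].
move=> Cconv Cvol Cpq; pose K (i : 'I_N) := u i.
have KC i : C (K i) by exact: (uC _ (ltn_ord i)).
have rangeK : range K = C.
  apply/seteqP; split => [_ [i _ <-]//|L /u_surj[k /= kN <-]].
  by exists (Ordinal kN).
have [||||Z [szZ vZ ZK]] := HP 'I_N K.
- by move=> i j /u_inj ij; apply/val_inj/ij; apply/mem_set; exact: ltn_ord.
- by move=> i; exact: Cconv.
- by move=> i; exact: Cvol.
- by rewrite rangeK.
pose T := (fun k => ellipsoid (nth (0, 0) Z k).1 (nth (0, 0) Z k).2) @` `I_(size Z).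
have /finite_setP[m Tm] : finite_set T by apply: finite_image; exact: finite_II.
have mH : (m <= H)%N.
  apply: leq_trans szZ; rewrite -card_le_II.
  by rewrite -(card_le_eql Tm); exact: card_image_le.
apply: (@le_trans _ _ (m%:R%:E)); last by rewrite lee_fin ler_nat.
apply: ereal_inf_lbound; exists m => //=; exists T => //; split.
  move=> _ [k /= kZ <-]; have vk := vZ _ (mem_nth (0, 0) kZ).
  have uk : (nth (0, 0) Z k).1 \in unitmx.
    rewrite unitmxE unitfE; apply: contraTneq (shrink_factor_gt0 n c_gt0) => h.
    move: vk; rewrite h normr0 mul0r => /eqP; rewrite eq_sym expf_eq0 /= => /eqP ->.
    by rewrite ltxx.
  split; last by rewrite volumeE// vk.
  by exists (nth (0, 0) Z k).1, (nth (0, 0) Z k).2.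
move=> L; rewrite -rangeK => -[i _ <-]; have [E EZ EK] := ZK i.
exists (ellipsoid E.1 E.2) => //; exists (index E Z); rewrite /= ?nth_index//.
by rewrite index_mem.
Qed.
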